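(* Let $(K,\nu)$ be a valued field and $\omega$ a valuation transcendental extension of $\nu$ to $K(x)$. Take a minimal pair of definition $(a,\gamma)$ for $\omega$. Assume that $\gamma>\overline{\nu}\,\overline{K}$, that is, $\gamma>\alpha$ for all $\alpha\in\overline{\nu}\,\overline{K}$. Then $$IC(K(x)|K,\omega)=(K(a)^h|K)^{\mathrm{sep}}.$$
   Context: Values are written additively, $\nu 0=\infty$; for a valued field $(L,\nu)$, $\nu L$ and $L\nu$ denote the value group and residue field. $\overline{K}$ is a fixed algebraic closure of $K$. An extension $\omega$ of $\nu$ to the rational function field $K(x)$ is value transcendental if $\dim_{\mathbb{Q}}\big((\omega K(x)/\nu K)\otimes_{\mathbb{Z}}\mathbb{Q}\big)=1$, residue transcendental if $\mathrm{trdeg}[K(x)\omega:K\nu]=1$, and valuation transcendental if it is one of these. Fix an extension $\overline{\nu}$ of $\nu$ to $\overline{K}$ and a common extension $\overline{\omega}$ of $\omega$ and $\overline{\nu}$ to $\overline{K}(x)$; also fix an extension of $\overline{\omega}$ to an algebraic closure $\overline{K(x)}$ of $\overline{K}(x)$. For $a\in\overline{K}$ and $\gamma$ in an ordered abelian group containing $\overline{\nu}\,\overline{K}$, $\overline{\nu}_{a,\gamma}$ is the valuation on $\overline{K}(x)$ determined by $\overline{\nu}_{a,\gamma}\big(\sum_i c_i(x-a)^i\big)=\min_i\{\overline{\nu}c_i+i\gamma\}$ ($c_i\in\overline{K}$). A pair $(a,\gamma)$ with $a\in\overline{K}$, $\gamma\in\overline{\omega}\,\overline{K}(x)$ is a pair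 of definition for $\omega$ if $\overline{\omega}=\overline{\nu}_{a,\gamma}$; it is a minimal pair of definition if moreover for every $b\in\overline{K}$, $\overline{\nu}(a-b)\geq\gamma$ implies $[K(a):K]\leq[K(b):K]$. $K(a)^h$ is the henselization of $K(a)$ inside $\overline{K}$ with respect to $\overline{\nu}$; $K(x)^h$ is the henselization of $(K(x),\omega)$ inside $\overline{K(x)}$ with respect to the fixed extension of $\overline{\omega}$; $IC(K(x)|K,\omega):=\overline{K}\cap K(x)^h$. For fields $K_1\subseteq K_2$, $(K_2|K_1)^{\mathrm{sep}}$ is the separable closure of $K_1$ in $K_2$ (the set of elements of $K_2$ separable-algebraic over $K_1$). *)

(* Defs.v *)
From HB Require Import structures.
From mathcomp Require Import all_boot all_order all_algebra all_field.
From mathcomp Require Import boolp classical_sets.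

Set Implicit Arguments.
Unset Strict Implicit.
Unset Printing Implicit Defensive.

Import Order.TTheory GRing.Theory Num.Theory.

Local Open Scope classical_set_scope.
Local Open Scope ring_scope.
Local Open Scope quotient_scope.

HB.mixin Record POrderedZmodule_isOrderedAbelianGroup G of
    Num.POrderedZmodule G := {
  oag_le_total : total (<=%R : rel G);
  oag_lerD2l : forall z x y : G, x <= y -> z + x <= z + y
}.

#[short(type="oagType")]
HB.structure Definition OrderedAbelianGroup :=
  { G of Num.POrderedZmodule G & POrderedZmodule_isOrderedAbelianGroup G }.

(* [option G] is the group with infinity adjoined, [None] being infinity. *)
Section ExtendedValues.
Variable G : oagType.
Implicit Types x y : option G.

Definition vle x y : bool :=
  match x, y with
  | _, None => true
  | None, Some _ => false
  | Some g, Some h => g <= h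
  end.

Definition vlt x y : bool := (x != y) && vle x y.

Definition vadd x y : option G :=
  match x, y with
  | Some g, Some h => Some (g + h)
  | _, _ => None
  end.

Definition vmin x y : option G := if vle x y then x else y.

End ExtendedValues.

Record valuation (L : fieldType) (G : oagType) := Valuation {
  val_fun :> L -> option G;
  val_inftyE : forall u, val_fun u = None <-> u = 0;
  valM : forall u t, val_fun (u * t) = vadd (val_fun u) (val_fun t);
  valD : forall u t, vle (vmin (val_fun u) (val_fun t)) (val_fun (u + t))
}.

(* All valuations take values in one ordered abelian group G, so that the
   embedding of the value group of v in that of w is an inclusion in G. *)
Definition extends (G : oagType) (k L : fieldType) (f : k -> L)
    (v : valuation k G) (w : valuation L G) : Prop :=
  forall c, w (f c) = v c.

Section ValuationTheory.
Variables (L : fieldType) (G : oagType) (v : valuation L G).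
Implicit Types u t : L.

Lemma vle_refl (x : option G) : vle x x.
Proof. by case: x => //= g; exact: lexx. Qed.

Lemma vle_trans (y x z : option G) : vle x y -> vle y z -> vle x z.
Proof. by case: x y z => [x|] [y|] [z|] //=; exact: le_trans. Qed.

Lemma vltNge (x y : option G) : vlt x y = ~~ vle y x.
Proof.
rewrite /vlt; case: x y => [g|] [h|] //=.
have /orP[gh|hg] := oag_le_total g h.
  rewrite gh andbT; apply/idP/idP; last by apply: contraNneq => -[->].
  by apply: contraNN => hg; apply/eqP; congr Some; apply: le_anti; rewrite gh.
rewrite hg /=; apply/negP => /andP[/eqP gh hg']; apply: gh; congr Some.
by apply: le_anti; rewrite hg hg'.
Qed.

Lemma val0 : v 0 = None.
Proof. exact/val_inftyE. Qed.

Lemma val_neq0 u : u != 0 -> exists g, v u = Some g.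
Proof.
by case E: (v u) => [g|]; [exists g | move/val_inftyE: E => ->; rewrite eqxx].
Qed.

Lemma val1 : v 1 = Some 0.
Proof.
have [g vg] := val_neq0 (oner_neq0 L).
have := valM v 1 1; rewrite mulr1 vg /= => -[] /eqP.
by rewrite -subr_eq0 opprD addrA subrr add0r oppr_eq0 => /eqP ->.
Qed.

Lemma oag_mul2_eq0 (g : G) : g + g = 0 -> g = 0.
Proof.
move=> g2; have gN : g = - g by apply/eqP; rewrite -addr_eq0 g2.
apply: le_anti; case/orP: (oag_le_total 0 g) => h.
  by have := oag_lerD2l (- g) _ _ h; rewrite addr0 addNr -gN h => ->.
by have := oag_lerD2l (- g) _ _ h; rewrite addr0 addNr -gN h => ->.
Qed.

Lemma valN u : v (- u) = v u.
Proof.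
have vN1 : v (-1) = Some 0.
  have [|g vg] := @val_neq0 (-1); first by rewrite oppr_eq0 oner_neq0.
  have := valM v (-1) (-1); rewrite mulrNN mulr1 val1 vg /= => -[] /esym.
  by move/oag_mul2_eq0 => ->.
by rewrite -mulN1r valM vN1; case: (v u) => //= g; rewrite add0r.
Qed.

Lemma valV u g : v u = Some g -> v u^-1 = Some (- g).
Proof.
move=> vu; have u0 : u != 0 by apply/eqP => u0; move: vu; rewrite u0 val0.
have [|h vh] := @val_neq0 u^-1; first by rewrite invr_eq0.
have := valM v u u^-1; rewrite divff // val1 vu vh /= => -[] /esym/eqP.
by rewrite addrC addr_eq0 => /eqP ->.
Qed.

Lemma valD_ge x u t : vle x (v u) -> vle x (v t) -> vle x (v (u + t)).
Proof.
move=> xu xt; apply: vle_trans (valD v u t); rewrite /vmin.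
by case: ifP.
Qed.

Lemma valD_gt x u t : vlt x (v u) -> vlt x (v t) -> vlt x (v (u + t)).
Proof.
rewrite !vltNge => xu xt; apply/negP => h.
have := vle_trans (valD v u t) h; rewrite /vmin.
by case: ifP => _; [rewrite (negPf xu) | rewrite (negPf xt)].
Qed.

End ValuationTheory.

Section ValueGroup.
Variables (L : fieldType) (G : oagType) (v : valuation L G).

Definition value_group : set G := [set g | exists u, v u = Some g].

Definition in_value_group : pred G := fun g => `[< value_group g >].

Lemma in_value_group_zmod_closed : zmod_closed in_value_group.
Proof.
split; first by apply/asboolP; exists 1; exact: val1.
move=> g h /asboolP[u vu] /asboolP[t vt]; apply/asboolP.
by exists (u * t^-1); rewrite valM vu (valV vt).
Qed.

HB.instance Definition _ :=
  GRing.isZmodClosed.Build G in_value_group in_value_group_zmod_closed.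

Record value_group_of := ValueGroupOf {
  vg_val :> G;
  vg_valP : vg_val \in in_value_group
}.

HB.instance Definition _ := [isSub for vg_val].
HB.instance Definition _ := [Choice of value_group_of by <:].
HB.instance Definition _ := [SubChoice_isSubZmodule of value_group_of by <:].

End ValueGroup.

Section ValueGroupQuotient.
Variables (k L : fieldType) (G : oagType).
Variables (v : valuation k G) (w : valuation L G).

Definition base_value_group : pred (value_group_of w) :=
  fun g => vg_val g \in in_value_group v.

Lemma base_value_group_zmod_closed : zmod_closed base_value_group.
Proof.
split=> [|x y xv yv]; rewrite -topredE /= /base_value_group.
  by rewrite -[vg_val _]/(val _) raddf0 rpred0.
by rewrite -[vg_val _]/(val _) raddfB; exact: rpredB xv yv.

Qed.

HB.instance Definition _ :=
  GRing.isZmodClosed.Build (value_group_of w) base_value_group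
    base_value_group_zmod_closed.

(* Meaningful when the value group of w contains that of v. *)
Definition value_group_quotient : zmodType :=
  {ideal_quot (GRing.ZmodClosed.clone (value_group_of w) base_value_group _)}.

End ValueGroupQuotient.

Definition biadditive (A B C : zmodType) (t : A -> B -> C) : Prop :=
  (forall a a' b, t (a + a') b = t a b + t a' b) /\
  (forall a b b', t a (b + b') = t a b + t a b').

(* (V, t) is the tensor product of M and rat over the integers: t is universal
   among biadditive maps, and rat acts on V through the second factor. *)
Definition is_tensor_rat (M : zmodType) (V : lmodType rat)
    (t : M -> rat -> V) : Prop :=
  [/\ biadditive t,
      forall q m r, q *: t m r = t m (q * r) &
      forall (C : zmodType) (b : M -> rat -> C), biadditive b ->
        exists! h : V -> C,
          zmod_morphism h /\ forall m r, h (t m r) = b m r].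

Definition dim_tensor_rat (M : zmodType) (n : nat) : Prop :=
  exists (V : vectType rat) (t : M -> rat -> V),
    is_tensor_rat t /\ \dim {: V} = n.

Section ResidueField.
Variables (L : fieldType) (G : oagType) (v : valuation L G).

Definition in_valuation_ring : pred L := fun u => vle (Some 0) (v u).

Lemma in_valuation_ring_subring_closed : subring_closed in_valuation_ring.
Proof.
split=> [|u t|u t]; rewrite !unfold_in /in_valuation_ring.
- by rewrite val1; exact: lexx.
- by move=> hu ht; apply: valD_ge => //; rewrite valN.
- rewrite valM; case: (v u) (v t) => [g|] [h|] //= hg hh.
  by apply: le_trans hg _; rewrite -{1}[g]addr0; exact: oag_lerD2l.
Qed.

HB.instance Definition _ :=
  GRing.isSubringClosed.Build L in_valuation_ring
    in_valuation_ring_subring_closed.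

Record valuation_ring := ValuationRing {
  vr_val :> L;
  vr_valP : vr_val \in in_valuation_ring
}.

HB.instance Definition _ := [isSub for vr_val].
HB.instance Definition _ := [Choice of valuation_ring by <:].
HB.instance Definition _ :=
  [SubChoice_isSubComNzRing of valuation_ring by <:].

Definition maximal_ideal : pred valuation_ring :=
  fun u => vlt (Some 0) (v (vr_val u)).

Lemma maximal_ideal_idealr_closed : idealr_closed maximal_ideal.
Proof.
split; rewrite ?unfold_in /maximal_ideal.
- by rewrite /= val0.
- by rewrite /= val1 vltNge vle_refl.
move=> [a ha] [u hu] [t ht]; rewrite !unfold_in /maximal_ideal /= => mu mt.
apply: valD_gt => //; rewrite valM.
move: ha; rewrite unfold_in /in_valuation_ring.
rewrite !vltNge in mu *; case: (v a) (v u) mu => [g|] [h|] //= h0 g0.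
apply: contraNN h0 => h0; apply: le_trans h0.
by rewrite addrC -{1}[h]addr0; exact: oag_lerD2l.
Qed.

HB.instance Definition _ :=
  isIdealr.Build valuation_ring maximal_ideal maximal_ideal_idealr_closed.

Definition residue_field :=
  {ideal_quot (Idealr.clone valuation_ring maximal_ideal _)}.

HB.instance Definition _ := GRing.ComNzRing.on residue_field.

Definition to_residue : valuation_ring -> residue_field :=
  \pi_{ideal_quot (Idealr.clone valuation_ring maximal_ideal _)}.

Lemma to_residue_is_zmod_morphism : zmod_morphism to_residue.
Proof. by move=> u t; rewrite /to_residue rmorphB. Qed.

Lemma to_residue_is_monoid_morphism : monoid_morphism to_residue.
Proof.
by split=> [|u t]; rewrite /to_residue ?rmorph1 ?rmorphM.
Qed.

HB.instance Definition _ :=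
  GRing.isZmodMorphism.Build valuation_ring residue_field to_residue
    to_residue_is_zmod_morphism.
HB.instance Definition _ :=
  GRing.isMonoidMorphism.Build valuation_ring residue_field to_residue
    to_residue_is_monoid_morphism.

Lemma to_residue_eq0 u : (to_residue u == 0) = (u \in maximal_ideal).
Proof.
by rewrite -(rmorph0 to_residue) /to_residue -Quotient.idealrBE subr0.
Qed.

Lemma to_residue_surj z : exists u, to_residue u = z.
Proof. by exists (repr z); exact: reprK. Qed.

Definition residue_inv (z : residue_field) : residue_field :=
  if z == 0 then 0 else to_residue (insubd 0 (vr_val (repr z))^-1).

Lemma residue_mulVf z : z != 0 -> residue_inv z * z = 1.
Proof.
move=> z0; rewrite /residue_inv (negPf z0).
have reprz : to_residue (repr z) = z by exact: reprK.
rewrite -{2}reprz; move: z0; rewrite -{1}reprz; move: (repr z) => u.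
rewrite to_residue_eq0 unfold_in /maximal_ideal vltNge negbK => u0.
have := vr_valP u; rewrite unfold_in /in_valuation_ring => u1.
have vu : v (vr_val u) = Some 0.
  by case: (v _) u0 u1 => [g|] //= h h'; congr Some; apply: le_anti; rewrite h.
have uV : (vr_val u)^-1 \in in_valuation_ring.
  by rewrite unfold_in /in_valuation_ring (valV vu) oppr0 vle_refl.
rewrite -rmorphM -(rmorph1 to_residue); congr to_residue.
have invE : vr_val (insubd 0 (vr_val u)^-1) = (vr_val u)^-1.
  exact: (insubdK 0 uV).
apply: val_inj; rewrite rmorphM rmorph1 /= invE mulVf //.
by apply/eqP => w0; move: vu; rewrite w0 val0.
Qed.

Lemma residue_inv0 : residue_inv 0 = 0.
Proof. by rewrite /residue_inv eqxx. Qed.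

HB.instance Definition _ :=
  GRing.ComNzRing_isField.Build residue_field residue_mulVf residue_inv0.

End ResidueField.

(* The image in the residue field of w of the residue field of v, for w
   extending v along f. *)
Definition base_residue_field (G : oagType) (k L : fieldType) (f : k -> L)
    (v : valuation k G) (w : valuation L G) : set (residue_field w) :=
  [set z | exists (c : valuation_ring v) (u : valuation_ring w),
     vr_val u = f (vr_val c) /\ z = to_residue u].

Arguments base_residue_field {G k L} f v w.

Definition is_subfield (L : fieldType) (F : set L) : Prop :=
  divring_closed (fun u => u \in F).

Definition subfield_adjoin (L : fieldType) (F : set L) (a : L) : set L :=
  smallest (@is_subfield L) (F `|` [set a]).

Definition algebraic_over (L : fieldType) (F : set L) (y : L) : Prop :=
  exists p : {poly L}, [/\ p != 0, (forall n, F p`_n) & root p y].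

(* L has a transcendence basis with n elements over its subfield F. *)
Fixpoint has_trdeg (L : fieldType) (F : set L) (n : nat) : Prop :=
  match n with
  | 0 => forall y, algebraic_over F y
  | n'.+1 => exists t, ~ algebraic_over F t /\
               has_trdeg (subfield_adjoin F t) n'
  end.

(* The extension F | k, with k embedded by i, is finite of degree n. *)
Definition has_degree (k L : fieldType) (i : {rmorphism k -> L}) (F : set L)
    (n : nat) : Prop :=
  exists b : 'I_n -> L, (forall j, F (b j)) /\
    (forall y, F y -> exists! c : {ffun 'I_n -> k},
       y = \sum_(j < n) i (c j) * b j).

(* The conditions on p say that p is the minimal polynomial of y over k. *)
Definition separable_over (k L : fieldType) (i : {rmorphism k -> L}) (y : L) :
    Prop :=
  exists p : {poly k}, [/\ p \is monic, irreducible_poly p,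
    root (map_poly i p) y & separable_poly p].

Definition separable_closure_in (k L : fieldType) (i : {rmorphism k -> L})
    (F : set L) : set L :=
  [set y | F y /\ separable_over i y].

Definition is_algebraic (k L : fieldType) (i : {rmorphism k -> L}) : Prop :=
  forall y, algebraicOver i y.

Definition ratfun (k : fieldType) : fieldType := {fraction {poly k}}.

Definition ratfun_poly (k : fieldType) (p : {poly k}) : ratfun k :=
  FracField.tofrac p.

Definition ratfun_const (k : fieldType) (c : k) : ratfun k := ratfun_poly c%:P.

Definition ratfun_map (k L : fieldType) (i : {rmorphism k -> L})
    (u : ratfun k) : ratfun L :=
  ratfun_poly (map_poly i \n_(repr u)) / ratfun_poly (map_poly i \d_(repr u)).

Lemma ratfun_reprE (k : fieldType) (u : ratfun k) :
  u = ratfun_poly \n_(repr u) / ratfun_poly \d_(repr u).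
Proof.
rewrite -{1}[u]reprK; move: (repr u) => x.
have dx : ratfun_poly \d_x != 0 by rewrite /ratfun_poly tofrac_eq0 denom_ratioP.
apply: (mulIf dx); rewrite divfK // /ratfun_poly /FracField.tofrac; unlock.
rewrite -[LHS]FracField.pi_mul /FracField.mulf.
apply/eqmodP; rewrite /= FracField.equivfE !numden_Ratio ?oner_eq0 //.
  by rewrite !mulr1 mulrC.
all: by rewrite mulr1 denom_ratioP.
Qed.

Lemma ratfun_map_frac (k L : fieldType) (i : {rmorphism k -> L})
    (p q : {poly k}) : q != 0 ->
  ratfun_map i (ratfun_poly p / ratfun_poly q) =
  ratfun_poly (map_poly i p) / ratfun_poly (map_poly i q).
Proof.
move=> q0; rewrite /ratfun_map; set u := ratfun_poly p / ratfun_poly q.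
have d0 : \d_(repr u) != 0 by exact: denom_ratioP.
have : ratfun_poly p * ratfun_poly \d_(repr u) =
       ratfun_poly \n_(repr u) * ratfun_poly q.
  apply/eqP; rewrite -eqr_div ?/ratfun_poly ?tofrac_eq0 //.
  by rewrite -[X in X == _]/u {1}[u]ratfun_reprE.
rewrite /ratfun_poly -!rmorphM => /eqP; rewrite tofrac_eq => /eqP pq.
apply/eqP; rewrite eqr_div ?tofrac_eq0 ?map_poly_eq0 //.
by rewrite -!(rmorphM (@FracField.tofrac _)) tofrac_eq -!rmorphM pq mulrC.
Qed.

Section ValuationTranscendental.
Variables (G : oagType) (K : fieldType).
Variables (nu : valuation K G) (omega : valuation (ratfun K) G).

Definition value_transcendental : Prop :=
  dim_tensor_rat (value_group_quotient nu omega) 1.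

Definition residue_transcendental : Prop :=
  has_trdeg (base_residue_field (@ratfun_const K) nu omega) 1.

Definition valuation_transcendental : Prop :=
  value_transcendental \/ residue_transcendental.

End ValuationTranscendental.

(* w is the valuation nubar_{a,gamma}; below p = \sum_i c_i X^i, so that
   p \Po ('X - a%:P) = \sum_i c_i (X - a)^i. *)
Definition is_monomial_valuation (G : oagType) (Kbar : fieldType)
    (nubar : valuation Kbar G) (a : Kbar) (gamma : G)
    (w : valuation (ratfun Kbar) G) : Prop :=
  forall p : {poly Kbar},
    w (ratfun_poly (p \Po ('X - a%:P))) =
    \big[@vmin G/None]_(i < size p) vadd (nubar p`_i) (Some (gamma *+ i)).

Section Pairs.
Variables (G : oagType) (K Kbar : fieldType) (i : {rmorphism K -> Kbar}).
Variables (nubar : valuation Kbar G) (omegabar : valuation (ratfun Kbar) G).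

Definition simple_ext (a : Kbar) : set Kbar := subfield_adjoin (range i) a.

Definition pair_of_definition (a : Kbar) (gamma : G) : Prop :=
  value_group omegabar gamma /\ is_monomial_valuation nubar a gamma omegabar.

Definition minimal_pair_of_definition (a : Kbar) (gamma : G) : Prop :=
  pair_of_definition a gamma /\
  forall b : Kbar, vle (Some gamma) (nubar (a - b)) ->
    forall m n, has_degree i (simple_ext a) m ->
      has_degree i (simple_ext b) n -> (m <= n)%N.

End Pairs.

(* For a subfield F of Om such that Om is an algebraic closure of F: the
   restriction of w to F has, up to equivalence, only one extension to Om.
   Valuations are equivalent when they have the same valuation ring. *)
Definition henselian (Om : fieldType) (G : oagType) (w : valuation Om G)
    (F : set Om) : Prop :=
  forall (G' : oagType) (w' : valuation Om G'),
    (forall u, F u -> (u \in in_valuation_ring w') = (u \in in_valuation_ring w)) ->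
    in_valuation_ring w' =i in_valuation_ring w.

(* For a subfield F of which Om is an algebraic closure. *)
Definition henselization (Om : fieldType) (G : oagType) (w : valuation Om G)
    (F : set Om) : set Om :=
  smallest (fun E => is_subfield E /\ henselian w E) F.

(* K(x) is seen in Om through j \o ratfun_map i, and Kbar through
   j \o ratfun_const. *)
Definition implicit_constant_field (G : oagType) (K Kbar Om : fieldType)
    (i : {rmorphism K -> Kbar}) (j : {rmorphism ratfun Kbar -> Om})
    (w : valuation Om G) : set Kbar :=
  [set y | henselization w (range (j \o ratfun_map i)) (j (ratfun_const y))].

(* Main.v *)
Require Import Defs.
From HB Require Import structures.
From mathcomp Require Import all_boot all_order all_algebra all_field.
From mathcomp Require Import boolp classical_sets.
From mathcomp Require Import ring.

Set Implicit Arguments.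
Unset Strict Implicit.
Unset Printing Implicit Defensive.

Import Order.TTheory GRing.Theory Num.Theory.

Local Open Scope classical_set_scope.
Local Open Scope ring_scope.

(* Since gamma exceeds all values of Kbar, omegabar is the composite of the
   (x - a)-adic place of Kbar(x), whose residue field is Kbar, with nubar.
   A perfect field is henselian exactly when the automorphisms of Om fixing it
   preserve w.

   If N is henselian and contains K(x), Krasner's argument shows that a is fixed
   by Aut(Om / N); the constants fixed by Aut(Om / N) then form a henselian field
   containing K(a), so every element of K(a)^h separable over K is in N.

   Conversely, the elements of Om separable over K(x) form a henselian field, and
   for every henselian E in Kbar containing K(a) the topological closure of the
   perfect closure of E(x) in Om is henselian and meets Kbar in the perfect
   closure of E. *)

(** * Subfields and extension of homomorphisms *)

(** Both henselizations are intersections of henselian fields, so none is ever constructed: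
    membership is proved by going through all henselian fields over the base, and bounded by
    henselian fields whose constants are known. The delicate one is the field over [E(x)]. Hensel's
    lemma is needed there although nothing is complete; but the root to be reached already exists in
    [Om], so a subfield closed in [Om] contains it as soon as Newton's approximations tend to it.
    They do because [Om] is algebraic over [Kbar(x)]: the (x - a)-adic place keeps rank one and
    residue field [Kbar], so that the powers of any infinitesimal exceed every value of [w] at a
    nonzero element. The starting approximation is a constant, found in the perfect closure of [E]
    because [E] is henselian. Arguing with automorphisms determines elements only up to pure
    inseparability. Hence separability over [K] is carried along separately, and each inclusion ends
    by playing it against a purely inseparable closure. *)

Section Subfields.
Variable L : fieldType.

Lemma is_subfieldP (F : set L) :
  is_subfield F <->
  [/\ F 1, forall u v, F u -> F v -> F (u - v) &
      forall u v, F u -> F v -> F (u / v)].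
Proof.
split=> [[F1 FB Fd]|[F1 FB Fd]].
  split=> [|u v Fu Fv|u v Fu Fv]; first exact: set_mem F1.
    by apply: set_mem; apply: FB; rewrite inE.
  by apply: set_mem; apply: Fd; rewrite inE.
split=> [|u v|u v]; rewrite !unfold_in !inE; [by []|exact: FB|exact: Fd].
Qed.

(** The proof [HF] is an argument so that the closure instance can be attached to this predicate. *)
Definition in_subfield (F : set L) (HF : is_subfield F) : pred L :=
  fun u => u \in F.

Section SubfieldType.
Variables (F : set L) (HF : is_subfield F).

HB.instance Definition _ :=
  GRing.isDivringClosed.Build L (in_subfield HF) HF.

Record subfield_of := SubfieldOf {
  sf_val :> L;
  sf_valP : sf_val \in in_subfield HF
}.

HB.instance Definition _ := [isSub for sf_val].
HB.instance Definition _ := [Choice of subfield_of by <:].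
HB.instance Definition _ :=
  [SubChoice_isSubIntegralDomain of subfield_of by <:].
HB.instance Definition _ := [SubIntegralDomain_isSubField of subfield_of by <:].

End SubfieldType.

(** Lets a subfield given as a set serve as a field of coefficients, so that minimal polynomials and
    divisibility are available over it. *)
Lemma subfield_range (F : set L) :
  is_subfield F ->
  exists (k : fieldType) (f : {rmorphism k -> L}), F = range f.
Proof.
move=> HF; exists (subfield_of HF), (val : subfield_of HF -> L).
apply/seteqP; split=> [u Fu|_ [u _ <-]]; last exact: set_mem (sf_valP u).
by exists (SubfieldOf (mem_set Fu : u \in in_subfield HF)).
Qed.

Lemma range_subfield (k : fieldType) (f : {rmorphism k -> L}) :
  is_subfield (range f).
Proof.
apply/is_subfieldP; split=> [|_ _ [u _ <-] [v _ <-]|_ _ [u _ <-] [v _ <-]].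
- by exists 1; rewrite ?rmorph1.
- by exists (u - v); rewrite ?rmorphB.
- by exists (u / v); rewrite ?fmorph_div.
Qed.

End Subfields.

Section SubfieldClosure.
Variables (L : fieldType) (F : set L) (HF : is_subfield F).

Lemma subfield1 : F 1. Proof. by case/is_subfieldP: HF. Qed.
Lemma subfieldB u v : F u -> F v -> F (u - v).
Proof. by case/is_subfieldP: HF => _ + _; apply. Qed.
Lemma subfield_div u v : F u -> F v -> F (u / v).
Proof. by case/is_subfieldP: HF => _ _; apply. Qed.
Lemma subfield0 : F 0.
Proof. by rewrite -(subrr 1); apply: subfieldB; exact: subfield1. Qed.
Lemma subfieldN u : F u -> F (- u).
Proof. by move=> Fu; rewrite -sub0r; apply: subfieldB => //; exact: subfield0. Qed.
Lemma subfieldD u v : F u -> F v -> F (u + v).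
Proof. by move=> Fu Fv; rewrite -[v]opprK; apply: subfieldB => //; exact: subfieldN. Qed.
Lemma subfieldV u : F u -> F u^-1.
Proof. by move=> Fu; rewrite -div1r; apply: subfield_div => //; exact: subfield1. Qed.
Lemma subfieldM u v : F u -> F v -> F (u * v).
Proof. by move=> Fu Fv; rewrite -[v]invrK; apply: subfield_div => //; exact: subfieldV. Qed.
Lemma subfieldX u n : F u -> F (u ^+ n).
Proof.
move=> Fu; elim: n => [|n IHn]; first by rewrite expr0; exact: subfield1.
by rewrite exprS; exact: subfieldM.
Qed.
Lemma subfield_sum (I : Type) (r : seq I) (P : pred I) (f : I -> L) :
  (forall i, P i -> F (f i)) -> F (\sum_(i <- r | P i) f i).
Proof.
by move=> Ff; apply: big_ind => //; [exact: subfield0|exact: subfieldD].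
Qed.
Lemma subfield_nat n : F n%:R.
Proof.
elim: n => [|n IHn]; first exact: subfield0.
by rewrite -[n.+1]addn1 natrD; apply: subfieldD => //; exact: subfield1.
Qed.
Lemma subfield_horner (p : {poly L}) u :
  (forall n, F p`_n) -> F u -> F p.[u].
Proof.
move=> Fp Fu; rewrite horner_coef; apply: subfield_sum => n _.
by apply: subfieldM => //; exact: subfieldX.
Qed.

End SubfieldClosure.

Lemma range_coef (k L : fieldType) (f : {rmorphism k -> L}) (p : {poly L}) :
  (forall n, range f p`_n) -> exists q, p = map_poly f q.
Proof.
move=> Fp; pose g n : k := xget 0 (fun c : k => f c = p`_n).
have fg n : f (g n) = p`_n.
  by have [c _ cE] := Fp n; rewrite /g; case: xgetP => [_ -> //|/(_ c)].
exists (\poly_(n < size p) g n); apply/polyP => n.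
rewrite coef_map coef_poly /=; case: (ltnP n) => np; last first.
  by rewrite nth_default // rmorph0.
exact/esym/fg.
Qed.

Lemma range_coef_map (k L : fieldType) (f : {rmorphism k -> L}) (q : {poly k}) :
  forall n, range f (map_poly f q)`_n.
Proof. by move=> n; rewrite coef_map /=; exists q`_n. Qed.

Lemma algebraic_over_range (k L : fieldType) (f : {rmorphism k -> L}) (y : L) :
  algebraic_over (range f) y <-> algebraicOver f y.
Proof.
split=> [[p [p0 /range_coef[q pE] py]]|[q q0 qy]].
  by exists q; [move: p0; rewrite pE map_poly_eq0|rewrite -pE].
exists (map_poly f q); split=> //; first by rewrite map_poly_eq0.
exact: range_coef_map.
Qed.

Lemma minimal_polynomial (k L : fieldType) (f : {rmorphism k -> L}) (y : L) :
  algebraicOver f y ->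
  exists m : {poly k}, [/\ m \is monic, irreducible_poly m,
    root (map_poly f m) y &
    forall p, root (map_poly f p) y -> m %| p].
Proof.
case=> p0 p00 p0y.
pose P n := `[< exists p : {poly k}, [/\ p != 0, root (map_poly f p) y &
                 size p = n] >].
have exP : exists n, P n by exists (size p0); apply/asboolP; exists p0.
have [n /asboolP[p [pn0 py sp]] minn] := ex_minnP exP.
have div_p q : root (map_poly f q) y -> p %| q.
  move=> qy; apply/modp_eq0P/eqP; apply: contraT => r0.
  have : P (size (q %% p)).
    apply/asboolP; exists (q %% p); split=> //.
    move: qy; rewrite [q in map_poly f q](divp_eq q p) rmorphD rmorphM /=.
    by rewrite /root !hornerE (rootP py) mulr0 add0r.
  by move=> /minn; rewrite -sp leqNgt ltn_modp pn0.
exists ((lead_coef p)^-1 *: p).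
have lp0 : (lead_coef p)^-1 != 0 by rewrite invr_eq0 lead_coef_eq0.
split.
- by rewrite monicE lead_coefZ mulVf // lead_coef_eq0.
- split=> [|q q1].
    rewrite size_scale // ltnNge; apply/negP => /size1_polyC pC.
    move: py; rewrite pC map_polyC rootC fmorph_eq0 => /eqP c0.
    by move: pn0; rewrite pC c0 polyC0 eqxx.
  rewrite dvdpZr // => qp; rewrite eqp_sym.
  rewrite (eqp_ltrans (eqp_scale _ lp0)) eqp_sym /eqp qp /=.
  have /dvdpP[r pE] := qp.
  (* If the cofactor [r] vanished at [y], then [p] would divide it, against the size of the
     nonconstant factor [q]. *)
  have : root (map_poly f r) y || root (map_poly f q) y.
    by rewrite -rootM -rmorphM -pE.
  case/orP=> [/div_p pr|/div_p //].
  have r0 : r != 0 by apply: contra_neq pn0 => r0; rewrite pE r0 mul0r.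
  have q0 : q != 0 by apply: contra_neq pn0 => q0; rewrite pE q0 mulr0.
  have := dvdp_leq r0 pr; rewrite pE size_mul // -subn1.
  have : (1 < size q)%N by rewrite ltn_neqAle eq_sym q1 size_poly_gt0.
  case: (size q) => [|[|s]] // _; rewrite !addnS subn1 /= -addnS -[X in (_ <= X)%N]addn0.
  by rewrite leq_add2l.
- by rewrite /root map_polyZ hornerZ (rootP py) mulr0.
- by move=> q /div_p; rewrite dvdpZl.
Qed.

Section MinimalPolynomialInverse.
Variables (k L : fieldType) (f : {rmorphism k -> L}) (z : L) (m : {poly k}).
Hypotheses (m_irr : irreducible_poly m) (mz : root (map_poly f m) z).

(** Bezout gives an inverse of [q] modulo [m] with coefficients in [k], so that one polynomial
    inverts [q] at every root of [m], in whatever extension. *)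
Lemma inverse_mod_minimal (q : {poly k}) :
  ~~ root (map_poly f q) z -> exists r, m %| q * r - 1.
Proof.
move=> qz; have m_q : coprimep m q.
  rewrite irreducible_poly_coprime //; apply: contra qz => /dvdpP[r ->].
  by rewrite rmorphM rootM mz orbT.
have [[u v] /= uv1] := Bezout_eq1_coprimepP m q m_q.
exists v; rewrite -uv1 opprD addrCA [q * v]mulrC subrr addr0 -mulNr.
exact: dvdp_mulIr.
Qed.

End MinimalPolynomialInverse.

Lemma horner_mod_inverse (k L : fieldType) (h : {rmorphism k -> L})
    (m q r : {poly k}) (y : L) :
  root (map_poly h m) y -> m %| q * r - 1 ->
  (map_poly h r).[y] = (map_poly h q).[y]^-1.
Proof.
move=> my m_qr; have : root (map_poly h (q * r - 1)) y.
  by move/dvdpP: m_qr => [s ->]; rewrite rmorphM rootM my orbT.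
rewrite /root rmorphB rmorph1 rmorphM !hornerE subr_eq0 => /eqP qr1.
have q0 : (map_poly h q).[y] != 0.
  apply/eqP => q0; move: qr1 (oner_neq0 L); rewrite q0 mul0r => <-.
  by rewrite eqxx.
by apply: (mulfI q0); rewrite qr1 divff.
Qed.

(** * Extension of embeddings into an algebraically closed field *)

Section Extension.
Variables (L : fieldType) (Om : closedFieldType).

(* The graph of a homomorphism to Om from a field between k and L. *)
Definition partial_embedding (k : fieldType) (f : {rmorphism k -> L})
    (g : {rmorphism k -> Om}) (R : set (L * Om)) : Prop :=
  [/\ forall c, R (f c, g c),
      forall u u' v v', R (u, v) -> R (u', v') -> R (u - u', v - v'),
      forall u u' v v', R (u, v) -> R (u', v') -> R (u / u', v / v') &
      forall v, R (0, v) -> v = 0].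

(** The relation is the graph of k(z) -> k(z'). It is single-valued because a polynomial vanishing
    at [z] is divisible by [m], and closed under division thanks to inverses modulo [m]. *)
Lemma partial_embedding_adjoin (k : fieldType) (f : {rmorphism k -> L})
    (g : {rmorphism k -> Om}) (z : L) (z' : Om) (m : {poly k}) :
  irreducible_poly m -> root (map_poly f m) z ->
  (forall p, root (map_poly f p) z -> m %| p) -> root (map_poly g m) z' ->
  partial_embedding f g
    [set x | exists p, x = ((map_poly f p).[z], (map_poly g p).[z'])].
Proof.
move=> m_irr mz m_min mz'.
have gz p : root (map_poly f p) z -> root (map_poly g p) z'.
  by move=> /m_min /dvdpP[r ->]; rewrite rmorphM rootM mz' orbT.
split=> [c|u u' v v' [p [-> ->]] [q [-> ->]]|u u' v v'|v [p [p0 ->]]].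
- by exists c%:P; rewrite !map_polyC !hornerC.
- by exists (p - q); rewrite !rmorphB /= !hornerE.
- move=> [p [-> ->]] [q [-> ->]].
  have [qz|qz] := boolP (root (map_poly f q) z).
    by exists 0; rewrite (rootP qz) (rootP (gz _ qz)) !invr0 !mulr0 !rmorph0 !horner0.
  have [r m_qr] := inverse_mod_minimal m_irr mz qz.
  exists (p * r); rewrite !rmorphM !hornerM.
  by rewrite (horner_mod_inverse mz m_qr) (horner_mod_inverse mz' m_qr).
- by apply/eqP/gz; rewrite /root -p0.
Qed.

Section Maximal.
Variables (k : fieldType) (f : {rmorphism k -> L}) (g : {rmorphism k -> Om}).
Variable R : set (L * Om).
Hypothesis R_pe : partial_embedding f g R.

Lemma partial_embedding_fun u v v' : R (u, v) -> R (u, v') -> v = v'.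
Proof.
move=> Rv Rv'; have [_ RB _ R0] := R_pe.
by apply/eqP; rewrite -subr_eq0; apply/eqP/R0; rewrite -(subrr u); exact: RB.
Qed.

Definition embedding_dom : set L := [set u | exists v, R (u, v)].

Lemma embedding_dom_subfield : is_subfield embedding_dom.
Proof.
have [Rc RB Rd _] := R_pe; apply/is_subfieldP; split.
- by exists 1; have := Rc 1; rewrite !rmorph1.
- by move=> u u' [v Rv] [v' Rv']; exists (v - v'); exact: RB.
- by move=> u u' [v Rv] [v' Rv']; exists (v / v'); exact: Rd.
Qed.

Lemma partial_embedding_rmorphism (k' : fieldType) (h : {rmorphism k' -> L}) :
  range h `<=` embedding_dom ->
  exists h' : {rmorphism k' -> Om}, forall c, R (h c, h' c).
Proof.
move=> hR; have [Rc RB Rd _] := R_pe.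
pose e c : Om := xget 0 (fun v : Om => R (h c, v)).
have eP c : R (h c, e c).
  have [|v Rv] := hR (h c); first by exists c.
  by rewrite /e; case: xgetP => [_ -> //|/(_ v)].
have e1 : e 1 = 1.
  by apply: (partial_embedding_fun (eP 1)); have := Rc 1; rewrite !rmorph1.
have eB : zmod_morphism e.
  by move=> c d; apply: (partial_embedding_fun (eP _)); rewrite rmorphB; exact: RB.
have eV c : e c^-1 = (e c)^-1.
  apply: (partial_embedding_fun (eP _)).
  rewrite fmorphV -[(h c)^-1]mul1r -[(e c)^-1]mul1r; apply: Rd => //.
  by have := Rc 1; rewrite !rmorph1.
have eM : monoid_morphism e.
  split=> // c d; apply: (partial_embedding_fun (eP _)).
  rewrite -[e d]invrK -eV -[d in h (c * d)]invrK fmorph_div.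
  by apply: Rd.
pose E : {rmorphism k' -> Om} :=
  HB.pack e (GRing.isZmodMorphism.Build _ _ e eB)
    (GRing.isMonoidMorphism.Build _ _ e eM).
by exists E.
Qed.

End Maximal.

Section Extend.
Variables (k : fieldType) (f : {rmorphism k -> L}) (g : {rmorphism k -> Om}).
Hypothesis f_alg : forall y, algebraicOver f y.

(** The minimal polynomial of [z] over the domain of [R], carried to [Om] by [R], has a root there
    to which [z] can be sent. *)
Lemma partial_embedding_dom_ext (R : set (L * Om)) (z : L) :
  partial_embedding f g R ->
  exists R', [/\ partial_embedding f g R', R `<=` R' & embedding_dom R' z].
Proof.
move=> Rpe.
have [k' [h hE]] := subfield_range (embedding_dom_subfield Rpe).
have [|h' hh'] := @partial_embedding_rmorphism _ _ _ _ Rpe k' h.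
  by rewrite hE.
have fh c : exists d, f c = h d.
  have : embedding_dom R (f c) by exists (g c); case: Rpe.
  by rewrite hE => -[d _ <-]; exists d.
have z_alg : algebraicOver h z.
  have [p p0 pz] := f_alg z.
  have [|q pE] := @range_coef _ _ h (map_poly f p).
    by move=> n; rewrite coef_map /=; have [d ->] := fh p`_n; exists d.
  exists q; last by rewrite -pE.
  by rewrite -(map_poly_eq0 h) -pE map_poly_eq0.
have [m [_ m_irr mz m_min]] := minimal_polynomial z_alg.
have /closed_rootP[z' mz'] : size (map_poly h' m) != 1%N.
  by rewrite size_map_poly neq_ltn orbC; case: m_irr => ->.
have R'pe := partial_embedding_adjoin m_irr mz m_min mz'.
set R' := [set x | _] in R'pe.
have RR' : R `<=` R'.
  move=> [u v] Ruv; have : embedding_dom R u by exists v.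
  rewrite hE => -[d _ dE]; exists d%:P; rewrite !map_polyC !hornerC -dE.
  congr pair; apply: (partial_embedding_fun Rpe Ruv); rewrite -dE; exact: hh'.
exists R'; split=> //.
  have [_ RB Rd R0] := R'pe; split=> // c.
  by apply: RR'; case: Rpe.
by exists z', 'X; rewrite !map_polyX !hornerX.
Qed.

Lemma partial_embedding_extends (R0 : set (L * Om)) :
  partial_embedding f g R0 ->
  exists h : {rmorphism L -> Om}, forall u v, R0 (u, v) -> h u = v.
Proof.
move=> R0pe.
(* [R0] is adjoined to every set because Zorn's lemma also considers the empty chain, whose union is
   empty and is no embedding. *)
have [S [Spe Smax]] : exists A, partial_embedding f g (R0 `|` A) /\
    forall B, A `<` B -> ~ partial_embedding f g (R0 `|` B).
  apply: (@Zorn_bigcup _ (fun A => partial_embedding f g (R0 `|` A))).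
  move=> C CP Ctot.
  have common x y : (R0 `|` \bigcup_(X in C) X) x ->
      (R0 `|` \bigcup_(X in C) X) y ->
      exists S, [/\ partial_embedding f g S,
        S `<=` R0 `|` \bigcup_(X in C) X, S x & S y].
    have sub X : C X -> R0 `|` X `<=` R0 `|` \bigcup_(X in C) X.
      by move=> CX u [?|?]; [left|right; exists X].
    move=> [R0x|[X CX Xx]] [R0y|[Y CY Yy]].
    - by exists R0; split=> // u ?; left.
    - by exists (R0 `|` Y); split=> //; [exact: CP|exact: sub|left|right].
    - by exists (R0 `|` X); split=> //; [exact: CP|exact: sub|right|left].
    - have [XY|YX] := Ctot _ _ CX CY.
        exists (R0 `|` Y); split=> //; [exact: CP|exact: sub|right|right] => //.
        exact: XY.
      exists (R0 `|` X); split=> //; [exact: CP|exact: sub|right|right] => //.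
      exact: YX.
  split=> [c|u u' v v' Uuv Uuv'|u u' v v' Uuv Uuv'|v Uv].
  - by left; case: R0pe.
  - have [S [Spe SU Sx Sy]] := common _ _ Uuv Uuv'.
    by apply: SU; case: Spe => _ + _ _; apply.
  - have [S [Spe SU Sx Sy]] := common _ _ Uuv Uuv'.
    by apply: SU; case: Spe => _ _ + _; apply.
  - have [S [Spe SU Sx Sy]] := common _ _ Uv Uv.
    by case: Spe => _ _ _; apply.
have dom z : embedding_dom (R0 `|` S) z.
  have [R' [R'pe RR' [v R'z]]] := partial_embedding_dom_ext z Spe.
  have R'E : R0 `|` R' = R'.
    by apply/seteqP; split=> [u [R0u|//]|u ?]; [apply: RR'; left|right].
  have R'S : R' `<=` S.
    apply: contrapT => R'S; apply: (Smax R'); last by rewrite R'E.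
    split=> [?|]; last by move=> ?; exact: R'S.
    by move=> Su; apply: RR'; right.
  by exists v; right; exact: R'S.
have [|h hS] := @partial_embedding_rmorphism _ _ _ _ Spe L idfun.
  by move=> u _; exact: dom.
exists h => u v R0uv; apply: (partial_embedding_fun Spe (hS u)).
by left.
Qed.

Lemma extend_rmorphism_root (m : {poly k}) (z : L) (z' : Om) :
  irreducible_poly m -> root (map_poly f m) z ->
  (forall p, root (map_poly f p) z -> m %| p) -> root (map_poly g m) z' ->
  exists h : {rmorphism L -> Om}, (forall c, h (f c) = g c) /\ h z = z'.
Proof.
move=> m_irr mz m_min mz'.
have [h hR] := partial_embedding_extends
  (partial_embedding_adjoin m_irr mz m_min mz').
exists h; split=> [c|]; apply: hR.
  by exists c%:P; rewrite !map_polyC !hornerC.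
by exists 'X; rewrite !map_polyX !hornerX.
Qed.

End Extend.
End Extension.

(** * Fixed fields and separable elements *)

Section FixedField.
Variable Om : closedFieldType.
Implicit Types (F : set Om) (t : {rmorphism Om -> Om}).

(** Endomorphisms stand for automorphisms: when [Om] is algebraic over [F], they permute the roots
    of each nonzero polynomial over [F] and are therefore onto. *)
Definition fixes F t : Prop := forall u, F u -> t u = u.

(* The purely inseparable closure of F, when Om is algebraic over F. *)
Definition fixed_field F : set Om := [set z | forall t, fixes F t -> t z = z].

Lemma fixed_field_subfield F : is_subfield (fixed_field F).
Proof.
apply/is_subfieldP; split=> [t _|u v Fu Fv t tF|u v Fu Fv t tF].
- exact: rmorph1.
- by rewrite rmorphB Fu ?Fv.
- by rewrite fmorph_div Fu ?Fv.
Qed.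

Lemma sub_fixed_field F : F `<=` fixed_field F.
Proof. by move=> u Fu t; exact. Qed.

Lemma fixes_sub F F' t : F `<=` F' -> fixes F' t -> fixes F t.
Proof. by move=> FF' tF' u /FF'; exact: tF'. Qed.

Lemma fixed_fieldS F F' : F `<=` F' -> fixed_field F `<=` fixed_field F'.
Proof. by move=> FF' u Fu t tF'; apply: Fu; exact: fixes_sub tF'. Qed.

Lemma fixed_fieldK F : fixed_field (fixed_field F) `<=` fixed_field F.
Proof. by move=> u Fu t tF; apply: Fu => v Fv; exact: Fv. Qed.

Lemma fixes_horner F t (p : {poly Om}) z :
  fixes F t -> (forall n, F p`_n) -> t p.[z] = p.[t z].
Proof.
move=> tF Fp; rewrite -horner_map; congr _.[_].
by apply/polyP => n; rewrite coef_map /= tF.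
Qed.

Lemma stable_perm t (s : seq Om) : uniq s -> (forall c, c \in s -> t c \in s) ->
  perm_eq (map t s) s.
Proof.
move=> us ts; apply: uniq_perm => //.
  by rewrite map_inj_uniq //; exact: fmorph_inj.
apply: (uniq_min_size _ _ _).2; rewrite ?size_map //.
  by rewrite map_inj_uniq //; exact: fmorph_inj.
by move=> _ /mapP[c cs ->]; exact: ts.
Qed.

Lemma fixed_prod_XsubC F (s : seq Om) : uniq s ->
  (forall t, fixes F t -> forall c, c \in s -> t c \in s) ->
  forall n, fixed_field F (\prod_(c <- s) ('X - c%:P))`_n.
Proof.
move=> us ts n t tF; rewrite -coef_map /= rmorph_prod.
rewrite (eq_bigr (fun c => 'X - (t c)%:P)) => [|c _]; last first.
  by rewrite rmorphB /= map_polyX map_polyC.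
by rewrite -(big_map t xpredT (fun c => 'X - c%:P)) (perm_big _ (stable_perm us (ts _ tF))).
Qed.

Variable F : set Om.
Hypotheses (HF : is_subfield F) (F_alg : forall y, algebraic_over F y).

Lemma conjugate_root (z z' : Om) :
  (forall p : {poly Om}, (forall n, F p`_n) -> root p z -> root p z') ->
  exists t : {rmorphism Om -> Om}, fixes F t /\ t z = z'.
Proof.
move=> zz'; have [k [f FE]] := subfield_range HF.
have f_alg y : algebraicOver f y by apply/algebraic_over_range; rewrite -FE.
have [m [_ m_irr mz m_min]] := minimal_polynomial (f_alg z).
have mz' : root (map_poly f m) z'.
  by apply: zz' => // n; rewrite FE; exact: range_coef_map.
have [t [tf tz]] := extend_rmorphism_root f_alg m_irr mz m_min mz'.
by exists t; split=> // u; rewrite FE => -[c _ <-].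
Qed.

(** The orbit of [z] is finite because it consists of roots of one polynomial over [F]. Listing it
    without repetition makes the polynomial with roots [s] separable. *)
Lemma orbitP (z : Om) :
  exists s : seq Om, [/\ uniq s, z \in s,
    (forall z', z' \in s <-> exists2 t, fixes F t & z' = t z) &
    forall t, fixes F t -> forall c, c \in s -> t c \in s].
Proof.
have [p [p0 Fp pz]] := F_alg z.
have [r pE] := closed_field_poly_normal p.
have rP z' : (exists2 t, fixes F t & z' = t z) -> z' \in r.
  move=> [t tF ->]; rewrite -root_prod_XsubC -(rootZ _ _ (_ : lead_coef p != 0)).
    by rewrite -pE /root -(fixes_horner z tF) // (rootP pz) rmorph0.
  by rewrite lead_coef_eq0.
exists (undup [seq z' <- r | `[< exists2 t, fixes F t & z' = t z >]]).
have sP z' : z' \in undup [seq z' <- r | `[< exists2 t, fixes F t & z' = t z >]] <->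
    exists2 t, fixes F t & z' = t z.
  rewrite mem_undup mem_filter; split=> [/andP[/asboolP] //|h].
  by rewrite rP // andbT; apply/asboolP.
split=> //; first exact: undup_uniq.
  by apply/sP; exists idfun.
move=> t tF c /sP[t' t'F ->]; apply/sP; exists (t \o t') => // u Fu /=.
by rewrite t'F ?tF.
Qed.

(** Every root of the minimal polynomial is a conjugate of [z], hence equal to [z]. *)
Lemma fixed_minimal_polynomial (k : fieldType) (f : {rmorphism k -> Om}) (z : Om) :
  F = range f -> fixed_field F z ->
  exists (m : {poly k}) (n : nat), [/\ map_poly f m = ('X - z%:P) ^+ n.+1 &
    forall p, root (map_poly f p) z -> m %| p].
Proof.
move=> FE zF.
have f_alg : algebraicOver f z by apply/algebraic_over_range; rewrite -FE.
have [m [m_mon _ mz m_min]] := minimal_polynomial f_alg.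
have [r mE] := closed_field_poly_normal (map_poly f m).
move: mE; rewrite (monicP _) ?map_monic // scale1r => mE.
have rz z' : z' \in r -> z' = z.
  rewrite -root_prod_XsubC -mE => mz'.
  have [|t [tF <-]] := @conjugate_root z z'; last exact: zF.
  move=> p; rewrite FE => /range_coef[q ->] /m_min /dvdpP[d ->].
  by rewrite rmorphM rootM mz' orbT.
have zr : z \in r by rewrite -root_prod_XsubC -mE.
have rE : r = nseq (size r) z by apply/all_pred1P/allP => z' /rz ->; rewrite /= eqxx.
exists m, (size r).-1; split=> //.
rewrite mE prednK; last by case: (r) zr.
by rewrite {1}rE big_nseq iter_mulr_1.
Qed.

(** [q] is the part of the degree n+1 of the minimal polynomial supported at the characteristic; in
    characteristic 0 it is 1. *)
Lemma fixed_field_pow (z : Om) : fixed_field F z ->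
  exists q, ([pchar Om].-nat q) /\ F (z ^+ q).
Proof.
move=> zF; have [k [f FE]] := subfield_range HF.
have [m [n [mE _]]] := fixed_minimal_polynomial FE zF.
pose q := (n.+1`_[pchar Om])%N; pose n' := (n.+1`_([pchar Om]^'))%N.
have nE : n.+1 = (q * n')%N by rewrite partnC.
have q_nat : [pchar Om].-nat q by exact: part_pnat.
have n'0 : (n'%:R : Om) != 0 by rewrite natf_neq0_pchar; exact: part_pnat.
exists q; split=> //.
have XzqE : ('X - z%:P) ^+ q = ('X - (z ^+ q)%:P) \Po 'X^q.
  rewrite exprDn_pchar; last by rewrite (eq_pnat _ (pchar_poly Om)).
  rewrite exprNn_pchar; last by rewrite (eq_pnat _ (pchar_poly Om)).
  by rewrite rmorphB /= comp_polyX comp_polyC rmorphXn.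
have n'1 : (0 < n')%N by case: (n') n'0 => //; rewrite eqxx.

(* The minimal polynomial is (X^q - z^q)^n'. Its second highest coefficient in X^q is - n' z^q, and
   n' is invertible in [F]. *)
have : F (((('X - z%:P) ^+ n.+1) : {poly Om})`_(n'.-1 * q)).
  by rewrite -mE FE; exact: range_coef_map.
rewrite nE exprM XzqE -rmorphXn /= coef_comp_poly_Xn ?part_gt0 //.
rewrite dvdn_mull // mulnK ?part_gt0 //.
have := @coefPn_prod_XsubC Om (nseq n' (z ^+ q)).
rewrite size_nseq big_nseq iter_mulr_1 big_nseq iter_addr_0 => -> //; last first.
  by rewrite -lt0n.
rewrite -mulr_natl => Fn'z.
have -> : z ^+ q = (- (n'%:R * z ^+ q)) / (- n'%:R).
  by rewrite invrN mulrNN mulrAC divff // mul1r.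
apply: subfield_div => //; apply: subfieldN => //; exact: subfield_nat.
Qed.

(** The minimal polynomial is a power of X - z dividing a separable polynomial, so its degree is
    1. *)
Lemma fixed_field_separable (z : Om) (p : {poly Om}) : fixed_field F z ->
  (forall n, F p`_n) -> separable_poly p -> root p z -> F z.
Proof.
move=> zF Fp p_sep pz; have [k [f FE]] := subfield_range HF.
have [m [n [mE m_min]]] := fixed_minimal_polynomial FE zF.
move: Fp; rewrite FE => /range_coef[p' pE].
have m_p : map_poly f m %| p by rewrite pE dvdp_map m_min // -pE.
have := dvdp_separable m_p p_sep.
have mE' : map_poly f m = \prod_(x <- nseq n.+1 z) ('X - x%:P).
  by rewrite mE big_nseq iter_mulr_1.
rewrite mE' separable_prod_XsubC; case: n mE mE' => [|n] mE _ /=.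
  move=> _.
  have : range f (- (map_poly f m)`_0).
    rewrite coef_map /=; exists (- m`_0) => //; by rewrite rmorphN.
  by rewrite mE expr1 coefB coefX coefC /= sub0r opprK.
by rewrite !inE eqxx.
Qed.

End FixedField.

Lemma algebraic_overS (L : fieldType) (F F' : set L) y :
  F `<=` F' -> algebraic_over F y -> algebraic_over F' y.
Proof. by move=> FF' [p [p0 Fp py]]; exists p; split=> // n; exact: FF'. Qed.

Lemma subfield_prod_XsubC (L : fieldType) (F : set L) (s : seq L) :
  is_subfield F -> (forall c, c \in s -> F c) ->
  forall n, F (\prod_(c <- s) ('X - c%:P))`_n.
Proof.
move=> HF; elim: s => [_|c s IHs Fs] n.
  by rewrite big_nil coef1; case: (n == 0%N); [exact: subfield1|exact: subfield0].
rewrite big_cons mulrBl coefB coefXM coefCM.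
have {}IHs := IHs (fun d ds => Fs d (mem_behead (ds : d \in behead (c :: s)))).
apply: subfieldB => //; last by apply: subfieldM => //; apply: Fs; rewrite inE eqxx.
by case: ifP => // _; exact: subfield0.
Qed.

Lemma prod_XsubC_separable (L : fieldType) (s : seq L) : uniq s ->
  separable_poly (\prod_(c <- s) ('X - c%:P)).
Proof. by rewrite separable_prod_XsubC. Qed.

(** No irreducibility is asked of [p], so that the product of X - c over an orbit is directly a
    witness. *)
Definition separable_elements (L : fieldType) (F : set L) : set L :=
  [set z | exists p : {poly L}, [/\ forall n, F p`_n, separable_poly p & root p z]].

Lemma separable_elementsS (L : fieldType) (F F' : set L) :
  F `<=` F' -> separable_elements F `<=` separable_elements F'.
Proof. by move=> FF' z [p [Fp ps pz]]; exists p; split=> // n; exact: FF'. Qed.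

Lemma separable_overP (k L : fieldType) (f : {rmorphism k -> L}) (y : L) :
  separable_over f y <-> separable_elements (range f) y.
Proof.
split=> [[p [_ _ py p_sep]]|[p [/range_coef[q ->] p_sep py]]].
  exists (map_poly f p); split=> //; first exact: range_coef_map.
  by rewrite separable_map.
have [|m [m_mon m_irr my m_min]] := @minimal_polynomial _ _ f y.
  exists q => //; apply: contraTneq p_sep => ->.
  by rewrite rmorph0 unlock deriv0 coprimep0 eqp01.
exists m; split=> //; apply: dvdp_separable (m_min _ py) _.
by rewrite -(separable_map f).
Qed.

(** * The field of separable elements *)

Section SeparableElements.
Variable Om : closedFieldType.
Implicit Types F : set Om.

Lemma pchar_pow_rmorphism q : [pchar Om].-nat q ->
  exists phi : {rmorphism Om -> Om}, forall x, phi x = x ^+ q.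
Proof.
move=> q_nat; pose e (x : Om) := x ^+ q.
have eB : zmod_morphism e.
  by move=> x y; rewrite /e exprDn_pchar // exprNn_pchar.
have eM : monoid_morphism e.
  by split=> [|x y]; rewrite /e ?expr1n ?exprMn.
pose E : {rmorphism Om -> Om} :=
  HB.pack e (GRing.isZmodMorphism.Build _ _ e eB)
    (GRing.isMonoidMorphism.Build _ _ e eM).
by exists E.
Qed.

(** The field is F(z). Its purpose is the last clause: an element of F(z) known only to be fixed by
    automorphisms, thus only up to pure inseparability, is in [F]. *)
Lemma adjoin_separable F z :
  is_subfield F -> (forall y, algebraic_over F y) -> separable_elements F z ->
  exists F', [/\ is_subfield F', F `<=` F', F' z &
    fixed_field F `&` F' `<=` F].
Proof.
move=> HF F_alg [p [Fp p_sep pz]].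
have [k [f FE]] := subfield_range HF.
have f_alg y : algebraicOver f y by apply/algebraic_over_range; rewrite -FE.
have [m [m_mon m_irr mz m_min]] := minimal_polynomial (f_alg z).
have Rpe := partial_embedding_adjoin m_irr mz m_min mz.
exists (embedding_dom [set x | exists q,
  x = ((map_poly f q).[z], (map_poly f q).[z])]); split.
- exact: embedding_dom_subfield Rpe.
- move=> u; rewrite FE => -[c _ <-].
  by exists (f c), c%:P; rewrite map_polyC hornerC.
- by exists z, 'X; rewrite map_polyX hornerX.
move=> t [tF [_ [q [tE _]]]].
have {q tE} [r rm tE] : exists2 r : {poly k}, (size r < size m)%N & t = (map_poly f r).[z].
  exists (q %% m); first by rewrite ltn_modp monic_neq0.
  by rewrite tE {1}(divp_eq q m) rmorphD rmorphM /= !hornerE (rootP mz) mulr0 add0r.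
have [s mE] := closed_field_poly_normal (map_poly f m).
move: mE; rewrite (monicP _) ?map_monic // scale1r => mE.
have us : uniq s.
  rewrite -separable_prod_XsubC -mE; apply: dvdp_separable p_sep.
  by move: Fp pz; rewrite FE => /range_coef[p' ->] /m_min; rewrite dvdp_map.
have ms : size m = (size s).+1.
  by rewrite -(size_map_poly f) mE size_prod_XsubC.
(* As [t] is fixed, [r] takes the value [t] at all conjugates of [z]. These are distinct and
   outnumber the degree of [r], so [r] is the constant [t]. *)
pose Q := map_poly f r - t%:P.
have Qs : all (root Q) s.
  apply/allP => x; rewrite -root_prod_XsubC -mE => mx.
  have [|h [hF hz]] := @conjugate_root _ _ HF F_alg z x.
    move=> d; rewrite FE => /range_coef[d' ->] /m_min /dvdpP[e ->].
    by rewrite rmorphM rootM mx orbT.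
  rewrite /root !hornerE -hz -(fixes_horner (F := F)) //; last first.
    by move=> n; rewrite FE; exact: range_coef_map.
  by rewrite -tE tF // subrr.
have Q0 : Q = 0.
  apply/eqP/negPn/negP => /max_poly_roots/(_ Qs us); apply/negP; rewrite -leqNgt.
  apply: leq_trans (size_polyD _ _) _; rewrite geq_max size_polyN size_map_poly.
  rewrite -ltnS -ms rm /=; apply: leq_trans (size_polyC_leq1 _) _.
  by case: m_irr; rewrite ms.
have -> : t = f r`_0.
  by have := congr1 (fun P : {poly Om} => P`_0) Q0;
    rewrite coefB coef_map coefC coef0 /= => /eqP; rewrite subr_eq0 => /eqP.
by rewrite FE; exists r`_0.
Qed.

Lemma adjoin_separable_seq F (s : seq Om) :
  is_subfield F -> (forall y, algebraic_over F y) ->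
  (forall c, c \in s -> separable_elements F c) ->
  exists F', [/\ is_subfield F', F `<=` F', forall c, c \in s -> F' c &
    fixed_field F `&` F' `<=` F].
Proof.
elim: s F => [|c s IHs] F HF F_alg s_sep.
  by exists F; split=> // u [].
have [F1 [HF1 FF1 F1c fF1]] := adjoin_separable HF F_alg (s_sep c (mem_head _ _)).
have [||F' [HF' F1F' F's fF']] := IHs F1 HF1.
- by move=> y; apply: algebraic_overS (F_alg y).
- by move=> d ds; apply: (separable_elementsS FF1); apply: s_sep; rewrite inE ds orbT.
exists F'; split=> //.
- exact: subset_trans F1F'.
- by move=> d; rewrite inE => /predU1P[->|/F's //]; exact: F1F'.
- move=> u [uF uF']; apply: fF1; split=> //; apply: fF'; split=> //.
  exact: fixed_fieldS uF.
Qed.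

Variable F : set Om.
Hypotheses (HF : is_subfield F) (F_alg : forall y, algebraic_over F y).

(** The polynomial whose roots are the conjugates of [y] has coefficients that are fixed by
    automorphisms and lie in a field generated by separable elements, hence lie in [F]. *)
Lemma separable_generated (y : Om) (s : seq Om) :
  (forall c, c \in s -> separable_elements F c) ->
  (forall F', is_subfield F' -> F `<=` F' -> (forall c, c \in s -> F' c) ->
     forall t, fixes F t -> F' (t y)) ->
  separable_elements F y.
Proof.
move=> s_sep ys.
have [F' [HF' FF' F's fF']] := adjoin_separable_seq HF F_alg s_sep.
have [o [uo yo oP ot]] := orbitP F_alg y.
exists (\prod_(c <- o) ('X - c%:P)); split.
- move=> n; apply: fF'; split; first exact: fixed_prod_XsubC.
  by apply: subfield_prod_XsubC => // c /oP[t tF ->]; exact: ys.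
- exact: prod_XsubC_separable.
- by rewrite root_prod_XsubC.
Qed.

Lemma separable_conjugate t z :
  fixes F t -> separable_elements F z -> separable_elements F (t z).
Proof.
move=> tF [p [Fp p_sep pz]]; exists p; split=> //.
by rewrite /root -(fixes_horner z tF Fp) (rootP pz) rmorph0.
Qed.

Lemma separable_elements_subfield : is_subfield (separable_elements F).
Proof.
have gen z z' y : separable_elements F z -> separable_elements F z' ->
    (forall F' (t : {rmorphism Om -> Om}), is_subfield F' ->
      F' (t z) -> F' (t z') -> F' (t y)) ->
    separable_elements F y.
  move=> zs z's yzz'.
  have [o [_ _ oP _]] := orbitP F_alg z.
  have [o' [_ _ o'P _]] := orbitP F_alg z'.
  apply: (@separable_generated _ (o ++ o')) => [c|F' HF' FF' F'o t tF].
    rewrite mem_cat => /orP[/oP|/o'P] [t tF ->]; exact: separable_conjugate.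
  by apply: yzz' => //; apply: F'o; rewrite mem_cat; apply/orP;
    [left; apply/oP|right; apply/o'P]; exists t.
apply/is_subfieldP; split=> [|z z' zs z's|z z' zs z's].
- exists ('X - 1%:P); split; last by rewrite root_XsubC.
    have := @subfield_prod_XsubC _ F [:: 1] HF; rewrite big_seq1; apply=> c.
    by rewrite inE => /eqP ->; exact: subfield1.
  have := @prod_XsubC_separable Om [:: 1]; rewrite big_seq1; exact.
- apply: (gen z z') => // F' t HF' F'z F'z'; rewrite rmorphB; exact: subfieldB.
- apply: (gen z z') => // F' t HF' F'z F'z'; rewrite fmorph_div; exact: subfield_div.
Qed.

Lemma sub_separable_elements : F `<=` separable_elements F.
Proof.
move=> u Fu; exists ('X - u%:P); split; last by rewrite root_XsubC.
  have := @subfield_prod_XsubC _ F [:: u] HF; rewrite big_seq1; apply=> c.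
  by rewrite inE => /eqP ->.
have := @prod_XsubC_separable Om [:: u]; rewrite big_seq1; exact.
Qed.

Lemma fixed_field_pow_seq (s : seq Om) :
  (forall c, c \in s -> fixed_field F c) ->
  exists q, [pchar Om].-nat q /\ forall c, c \in s -> F (c ^+ q).
Proof.
elim: s => [_|c s IHs Fs]; first by exists 1%N.
have [q [q_nat Fq]] := IHs (fun d ds => Fs d (mem_behead (ds : d \in behead (c :: s)))).
have [q' [q'_nat Fq']] := fixed_field_pow HF F_alg (Fs c (mem_head _ _)).
exists (q * q')%N; split; first by rewrite pnatM q_nat.
move=> d; rewrite inE => /predU1P[->|ds].
  by rewrite mulnC exprM; exact: subfieldX.
by rewrite exprM; apply: subfieldX => //; exact: Fq.
Qed.

(** The orbit polynomial of [z] has coefficients purely inseparable over [F]; a power of Frobenius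
    brings them into [F] and, being injective, keeps the roots distinct. *)
Lemma separable_pow (z : Om) :
  exists q, [pchar Om].-nat q /\ separable_elements F (z ^+ q).
Proof.
have [o [uo yo oP ot]] := orbitP F_alg z.
pose h := \prod_(c <- o) ('X - c%:P).
have [|q [q_nat Fq]] := @fixed_field_pow_seq h.
  by move=> _ /(nthP 0)[n _ <-]; exact: fixed_prod_XsubC.
have [phi phiE] := pchar_pow_rmorphism q_nat.
exists q; split=> //; exists (map_poly phi h); split.
- move=> n; rewrite coef_map /= phiE.
  have [nh|nh] := ltnP n (size h); first by apply: Fq; rewrite mem_nth.
  rewrite nth_default // expr0n; case: q q_nat {Fq phiE} => // q _.
  exact: subfield0.
- by rewrite separable_map; exact: prod_XsubC_separable.
- by rewrite -phiE fmorph_root root_prod_XsubC.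
Qed.

End SeparableElements.

(** * Valuations and henselian fields *)

Section ExtendedOrder.
Variable G : oagType.
Implicit Types x y z : option G.

Lemma vle_total x y : vle x y || vle y x.
Proof. by case: x y => [g|] [h|] //=; exact: oag_le_total. Qed.

Lemma vleNgt x y : vle x y = ~~ vlt y x.
Proof. by rewrite vltNge negbK. Qed.

Lemma vltW x y : vlt x y -> vle x y.
Proof. by rewrite /vlt => /andP[]. Qed.

Lemma vle_anti x y : vle x y -> vle y x -> x = y.
Proof.
move=> xy yx; apply/eqP; apply: contraLR (xy) => nxy.
by rewrite -vltNge /vlt eq_sym nxy.
Qed.

Lemma vlt_le_trans y x z : vlt x y -> vle y z -> vlt x z.
Proof.
rewrite !vltNge => xy yz; apply: contraNN xy; exact: vle_trans.
Qed.

Lemma vle_lt_trans y x z : vle x y -> vlt y z -> vlt x z.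
Proof.
rewrite !vltNge => xy yz; apply: contraNN yz => zx; exact: vle_trans xy.
Qed.

Lemma vltxx x : vlt x x = false.
Proof. by rewrite /vlt eqxx. Qed.

Lemma vle_None x : vle x None.
Proof. by case: x. Qed.

Lemma vle_vadd x y z : vle x y -> vle (vadd x z) (vadd y z).
Proof.
case: x y z => [g|] [h|] [l|] //= gh.
by rewrite ![_ + l]addrC; exact: oag_lerD2l.
Qed.

End ExtendedOrder.

Section ValuationInequalities.
Variables (L : fieldType) (G : oagType) (v : valuation L G).
Implicit Types a b c d u z : L.

Lemma val_eqNone u : (v u == None) = (u == 0).
Proof. by apply/eqP/eqP; case: (val_inftyE v u). Qed.

Lemma vle_mul2r c a b : c != 0 -> vle (v (a * c)) (v (b * c)) = vle (v a) (v b).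
Proof.
move=> c0; have mono x e f : vle (v e) (v f) -> vle (v (e * x)) (v (f * x)).
  by rewrite !Defs.valM; exact: vle_vadd.
by apply/idP/idP => [/(mono c^-1)|/mono //]; rewrite !mulfK.
Qed.

Lemma vlt_mul2r c a b : c != 0 -> vlt (v (a * c)) (v (b * c)) = vlt (v a) (v b).
Proof. by move=> c0; rewrite !vltNge vle_mul2r. Qed.

Lemma vle_mul2l c a b : c != 0 -> vle (v (c * a)) (v (c * b)) = vle (v a) (v b).
Proof. by rewrite ![c * _]mulrC; exact: vle_mul2r. Qed.

Lemma vle_mul a b c d :
  vle (v a) (v b) -> vle (v c) (v d) -> vle (v (a * c)) (v (b * d)).
Proof.
move=> ab; have [->|c0 cd] := eqVneq c 0.
  have [->|d0] := eqVneq d 0; first by rewrite !mulr0 val0.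
  by have [g vd] := val_neq0 v d0; rewrite vd (val0 v).
apply: (vle_trans (y := v (b * c))); first by rewrite vle_mul2r.
have [->|b0] := eqVneq b 0; first by rewrite !mul0r val0.
by rewrite vle_mul2l.
Qed.

Lemma vlt_neq0 a b : vlt (v a) (v b) -> a != 0.
Proof. by apply: contraTneq => ->; rewrite val0 vltNge vle_None. Qed.

Lemma vlt_mul a b c d :
  vlt (v a) (v b) -> vle (v c) (v d) -> c != 0 -> vlt (v (a * c)) (v (b * d)).
Proof.
move=> ab cd c0; apply: (vlt_le_trans (y := v (b * c))).
  by rewrite vlt_mul2r.
by apply: vle_mul => //; exact: vle_refl.
Qed.

Lemma vle_exp a b n : vle (v a) (v b) -> vle (v (a ^+ n)) (v (b ^+ n)).
Proof.
by move=> ab; elim: n => [|n IHn]; rewrite ?expr0 ?vle_refl // !exprS; exact: vle_mul.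
Qed.

Lemma vlt_exp a b n : (0 < n)%N -> vlt (v a) (v b) -> vlt (v (a ^+ n)) (v (b ^+ n)).
Proof.
case: n => // n _ ab; rewrite !exprS; apply: vlt_mul => //.
  by apply: vle_exp; exact: vltW.
by rewrite expf_neq0 // (vlt_neq0 ab).
Qed.

Lemma vle_sum (I : Type) (r : seq I) (P : pred I) (f : I -> L) x :
  (forall i, P i -> vle x (v (f i))) -> vle x (v (\sum_(i <- r | P i) f i)).
Proof.
move=> xf; apply: (big_ind (fun u => vle x (v u))) => //.
  by rewrite val0 vle_None.
by move=> a b; exact: valD_ge.
Qed.

Lemma vlt_sum (I : eqType) (r : seq I) (P : pred I) (f : I -> L) a :
  a != 0 -> (forall i, i \in r -> P i -> vlt (v a) (v (f i))) ->
  vlt (v a) (v (\sum_(i <- r | P i) f i)).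
Proof.
move=> a0 af; rewrite big_seq_cond; apply: (big_ind (fun u => vlt (v a) (v u))).
- by rewrite val0 /vlt vle_None andbT val_eqNone.
- by move=> b c; exact: valD_gt.
- by move=> i /andP[]; exact: af.
Qed.

Lemma valB_gt x a b : vlt x (v a) -> vlt x (v b) -> vlt x (v (a - b)).
Proof. by move=> xa xb; apply: valD_gt; rewrite ?valN. Qed.

Lemma val_distC a b : v (a - b) = v (b - a).
Proof. by rewrite -valN opprB. Qed.

Lemma valD_lt a b : vlt (v a) (v b) -> v (a + b) = v a.
Proof.
move=> ab; apply: vle_anti; last by apply: valD_ge; [exact: vle_refl|exact: vltW].
rewrite vleNgt; apply/negP => h.
by have := valB_gt h ab; rewrite addrK vltxx.
Qed.

Lemma val_close a b : vlt (v a) (v (a - b)) -> v b = v a.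
Proof.
move=> h; have -> : b = a + (b - a) by rewrite addrC subrK.
by apply: valD_lt; rewrite val_distC.
Qed.

Lemma vlt_inv a b : a != 0 -> b != 0 -> vlt (v a^-1) (v b^-1) = vlt (v b) (v a).
Proof.
move=> a0 b0; rewrite -(vlt_mul2r (c := a * b)) ?mulf_neq0 // mulKf //.
by rewrite mulrCA mulVf // mulr1.
Qed.

(** Writing the value 0 as [v 1] turns every comparison into one between values of field elements,
    where the multiplicative lemmas above apply. *)
Lemma in_ringE u : (u \in in_valuation_ring v) = vle (v 1) (v u).
Proof. by rewrite Defs.val1. Qed.

Lemma vle_mul_ring x u :
  u \in in_valuation_ring v -> vle (v x) (v (x * u)).
Proof.
rewrite in_ringE => u1; rewrite -[X in vle (v X) _]mulr1.
by apply: vle_mul => //; exact: vle_refl.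
Qed.

(** Expresses the maximal ideal through the valuation ring, so that it can be transferred between
    valuations known only to share their ring. *)
Lemma in_idealE u :
  vlt (v 1) (v u) = (u == 0) || (u^-1 \notin in_valuation_ring v).
Proof.
have [->|u0] /= := eqVneq u 0; first by rewrite val0 Defs.val1.
rewrite in_ringE -vltNge -[in RHS](invr1) vlt_inv ?oner_neq0 //.
Qed.

Lemma val_exp_inj a b n : (0 < n)%N -> vle (v (a ^+ n)) (v (b ^+ n)) -> vle (v a) (v b).
Proof. by move=> n0; rewrite !vleNgt; apply: contraNN; exact: vlt_exp. Qed.

Lemma vlt_prod (s : seq L) g : g != 0 ->
  (forall c, c \in s -> vle (v g) (v c)) ->
  (exists2 c, c \in s & vlt (v g) (v c)) ->
  vlt (v (g ^+ size s)) (v (\prod_(c <- s) c)).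
Proof.
move=> g0; elim: s => [|c s IHs] gs [d ds gd] //; rewrite big_cons exprS.
have gs' e : e \in s -> vle (v g) (v e) by move=> es; apply: gs; rewrite inE es orbT.
have le_s : vle (v (g ^+ size s)) (v (\prod_(c <- s) c)).
  elim: (s) gs' => [|e r IHr] gr; first by rewrite big_nil vle_refl.
  rewrite big_cons exprS; apply: vle_mul; first by apply: gr; rewrite mem_head.
  by apply: IHr => f fr; apply: gr; rewrite inE fr orbT.
move: ds; rewrite inE => /predU1P[dc|ds].
  by rewrite -dc; apply: vlt_mul => //; rewrite expf_neq0.
rewrite mulrC [c * _]mulrC; apply: vlt_mul => //.
  by apply: IHs => //; exists d.
by apply: gs; rewrite mem_head.
Qed.

Lemma val_prod_const (s : seq L) g :
  (forall c, c \in s -> v c = v g) -> v (\prod_(c <- s) c) = v (g ^+ size s).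
Proof.
elim: s => [_|c s IHs gs]; first by rewrite big_nil.
rewrite big_cons exprS !Defs.valM gs ?mem_head // IHs // => d ds.
by apply: gs; rewrite inE ds orbT.
Qed.

End ValuationInequalities.

(** * Criteria for being henselian *)

Section Henselian.

Definition val_comp (L L' : fieldType) (G : oagType) (w : valuation L' G)
    (t : {rmorphism L -> L'}) : valuation L G.
Proof.
exists (fun u => w (t u)) => [u|u u'|u u'].
- split=> [/val_inftyE/eqP|->]; last by rewrite rmorph0 val0.
  by rewrite fmorph_eq0 => /eqP.
- by rewrite rmorphM Defs.valM.
- by rewrite rmorphD; exact: valD.
Defined.

Lemma val_compE (L L' : fieldType) (G : oagType) (w : valuation L' G)
    (t : {rmorphism L -> L'}) u : val_comp w t u = w (t u).
Proof. by []. Qed.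

Lemma henselian_invariant (Om : closedFieldType) (G : oagType)
    (w : valuation Om G) (F : set Om) (t : {rmorphism Om -> Om}) u :
  henselian w F -> fixes F t ->
  (t u \in in_valuation_ring w) = (u \in in_valuation_ring w).
Proof.
move=> w_hens tF; apply: (w_hens G (val_comp w t)) => c Fc.
by rewrite !in_ringE /= rmorph1 tF.
Qed.

Lemma invariant_ideal (Om : closedFieldType) (G : oagType)
    (w : valuation Om G) (t : {rmorphism Om -> Om}) u :
  (forall z, (t z \in in_valuation_ring w) = (z \in in_valuation_ring w)) ->
  vlt (w 1) (w (t u)) = vlt (w 1) (w u).
Proof. by move=> tO; rewrite !in_idealE fmorph_eq0 -fmorphV tO. Qed.

(** Dividing p(u) = 0 by u^d, with d the degree, writes 1 as minus the sum of these terms, and 1 is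
    not in the maximal ideal. *)
Lemma monic_root_ideal (L : fieldType) (G : oagType) (v : valuation L G)
    (p : {poly L}) (u : L) :
  p \is monic -> root p u -> u != 0 ->
  ~ (forall n, (n < (size p).-1)%N ->
       vlt (v 1) (v (p`_n * u^-1 ^+ ((size p).-1 - n)))).
Proof.
move=> p_mon pu u0 p_small; set d := (size p).-1 in p_small.
have sp : size p = d.+1 by rewrite prednK // size_poly_gt0 monic_neq0.
have : 1 = - \sum_(n < d) p`_n * u^-1 ^+ (d - n).
  apply/eqP; rewrite -addr_eq0 addrC.
  have -> : 1 = p`_d * u^-1 ^+ (d - d) by rewrite subnn mulr1 -(monicP p_mon).
  rewrite -(big_ord_recr d (fun n => p`_n * u^-1 ^+ (d - n))) /=.
  apply/eqP/(mulIf (expf_neq0 d u0)); rewrite mul0r -[RHS](rootP pu) horner_coef sp mulr_suml.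
  apply: eq_bigr => n _; rewrite -mulrA; congr (_ * _).
  rewrite exprVn -[X in _ * u ^+ X](subnK (ltnSE (ltn_ord n))) exprD mulKf //.
  exact: expf_neq0.
move/(congr1 v); rewrite valN => h.
have := @vlt_sum _ _ v _ (index_enum 'I_d) xpredT
  (fun n : 'I_d => p`_n * u^-1 ^+ (d - n)) 1 (oner_neq0 _).
rewrite -h vltxx => sum_small; suff: false by [].
by apply: sum_small => n _ _; exact: p_small.
Qed.

Lemma prod_XsubC_ideal (L : fieldType) (G : oagType) (v : valuation L G)
    (s : seq L) : (forall c, c \in s -> vlt (v 1) (v c)) ->
  forall n, (n < size s)%N -> vlt (v 1) (v (\prod_(c <- s) ('X - c%:P))`_n).
Proof.
have OM (a b : L) : vlt (v 1) (v a) -> vle (v 1) (v b) -> vlt (v 1) (v (a * b)).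
  by move=> a1 b1; rewrite -[X in v X]mulr1; apply: vlt_mul; rewrite ?oner_neq0.
elim: s => // c s IHs c1 n; rewrite ltnS => ns.
have {}IHs := IHs (fun d ds => c1 d (mem_behead (ds : d \in behead (c :: s)))).
rewrite big_cons mulrBl coefB coefXM coefCM; apply: valB_gt.
  case: n ns => [|n] ns /=; last exact: IHs.
  by rewrite val0 Defs.val1.
apply: OM; first by rewrite c1 ?mem_head.
move: ns; rewrite leq_eqVlt => /predU1P[->|/IHs/vltW //].
have := monicP (monic_prod_XsubC s xpredT id).
by rewrite lead_coefE size_prod_XsubC /= => ->; exact: vle_refl.
Qed.

Lemma henselian_conjugates (L : fieldType) (G : oagType) (w : valuation L G)
    (F : set L) : is_subfield F ->
  (forall z, exists s : seq L, [/\ z \in s,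
     forall n, F (\prod_(c <- s) ('X - c%:P))`_n,
     forall c, c \in s -> z \in in_valuation_ring w -> c \in in_valuation_ring w &
     forall c, c \in s -> vlt (w 1) (w z) -> vlt (w 1) (w c)]) ->
  henselian w F.
Proof.
move=> HF conj G' w' w'F z; have FM c : F c -> vlt (w' 1) (w' c) = vlt (w 1) (w c).
  by move=> Fc; rewrite !in_idealE w'F //; exact: subfieldV.
(* If [z] is in the ring of [w], so are all roots and hence the coefficients; these lie in [F], so
   also in the ring of [w'], over which [z] is therefore integral. *)
apply/idP/idP => zO; last first.
  have [s [zs Fs sO _]] := conj z.
  have sz c : c \in s -> c \in in_valuation_ring w by move=> /sO; apply.
  apply: contraT => z'O; have z'M : vlt (w' 1) (w' z^-1).
    by rewrite in_idealE invrK z'O orbT.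
  have z0 : z != 0 by apply: contraNneq z'O => ->; rewrite rpred0.
  have := monic_root_ideal (v := w') (monic_prod_XsubC s xpredT id) _ z0.
  rewrite root_prod_XsubC zs size_prod_XsubC /= => /(_ isT) [] n ns.
  have pO : (\prod_(c <- s) ('X - c%:P))`_n \in in_valuation_ring w'.
    rewrite w'F //; move: n {ns}; apply/polyOverP.
    rewrite big_seq; apply: rpred_prod => c cs.
    by rewrite polyOverXsubC sz.
  rewrite -[X in w' X]mul1r mulrC [_`_n * _]mulrC; apply: vlt_mul; last exact: oner_neq0.
    by rewrite -[X in w' X](expr1n _ (size s - n)); apply: vlt_exp; rewrite // subn_gt0.
  by rewrite -in_ringE.
(* Otherwise [z^-1] is in the maximal ideal of [w], and so are the lower coefficients of its
   polynomial. They are then in the maximal ideal of [w'], which is impossible since [z] is in the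
   ring of [w']. *)
apply: contraT => zO'; have z0 : z != 0 by apply: contraNneq zO' => ->; rewrite rpred0.
have zM : vlt (w 1) (w z^-1) by rewrite in_idealE invrK zO' orbT.
have [s [zs Fs _ sM]] := conj z^-1.
have := monic_root_ideal (v := w') (monic_prod_XsubC s xpredT id) _ (_ : z^-1 != 0).
rewrite root_prod_XsubC zs size_prod_XsubC invr_eq0 z0 /= => /(_ isT isT) [] n ns.
rewrite -[X in w' X]mul1r mulrC mulr1 invrK.
rewrite -[X in w' X]mulr1; apply: vlt_mul; last exact: oner_neq0.
  rewrite FM //; apply: prod_XsubC_ideal => // c cs; exact: sM.
by rewrite -in_ringE rpredX.
Qed.

(** A valuation ring contains an element exactly when it contains a positive power of it, so [F]
    decides membership. *)
Lemma henselian_powers (L : fieldType) (G : oagType) (w : valuation L G)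
    (F : set L) :
  (forall z, exists2 q, (0 < q)%N & F (z ^+ q)) -> henselian w F.
Proof.
move=> Fpow G' w' w'F z; have [q q0 Fzq] := Fpow z.
have powO (H : oagType) (v : valuation L H) :
    (z ^+ q \in in_valuation_ring v) = (z \in in_valuation_ring v).
  apply/idP/idP => [|zO]; last exact: rpredX.
  by rewrite !in_ringE -{1}[1](expr1n _ q); exact: val_exp_inj.
by rewrite -!powO w'F.
Qed.

End Henselian.

(** * The place of Kbar(x) at a *)

Section RationalFunctions.

Lemma ratfun_coprime (k : fieldType) (u : ratfun k) :
  exists p q, [/\ coprimep p q, q != 0 & u = ratfun_poly p / ratfun_poly q].
Proof.
have q0 : \d_(repr u) != 0 by exact: denom_ratioP.
rewrite [u]ratfun_reprE; move: (\n_(repr u)) (\d_(repr u)) q0 => p q q0 {u}.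
have g0 : gcdp p q != 0 by rewrite gcdp_eq0 (negPf q0) andbF.
exists (p %/ gcdp p q), (q %/ gcdp p q).
have qE := divpK (dvdp_gcdr p q); have pE := divpK (dvdp_gcdl p q).
split; first by rewrite coprimep_div_gcd // q0 orbT.
  by apply: contra_neq q0 => q'0; rewrite -qE q'0 mul0r.
have q'0 : q %/ gcdp p q != 0 by apply: contra_neq q0 => q'0; rewrite -qE q'0 mul0r.
apply/eqP; rewrite eqr_div ?/ratfun_poly ?tofrac_eq0 // -!rmorphM tofrac_eq.
move: (p %/ gcdp p q) (q %/ gcdp p q) pE qE {q'0} => p' q' pE qE.
by rewrite -[X in X * _ == _]pE -[X in _ == _ * X]qE mulrAC mulrA.
Qed.

Variables (k L : fieldType) (i : {rmorphism k -> L}).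

Lemma ratfun_map_zmod_morphism : zmod_morphism (ratfun_map i).
Proof.
move=> u u'; have [p [q [_ q0 ->]]] := ratfun_coprime u.
have [p' [q' [_ q'0 ->]]] := ratfun_coprime u'.
have tq (F : fieldType) (d : {poly F}) : (ratfun_poly d != 0) = (d != 0).
  by rewrite /ratfun_poly tofrac_eq0.
have -> : ratfun_poly p / ratfun_poly q - ratfun_poly p' / ratfun_poly q' =
    ratfun_poly (p * q' - p' * q) / ratfun_poly (q * q').
  rewrite -mulNr addf_div ?tq // /ratfun_poly rmorphB !rmorphM /=.
  by rewrite mulNr.
rewrite !ratfun_map_frac ?mulf_neq0 // -[in RHS]mulNr [RHS]addf_div ?tq ?map_poly_eq0 //.
by rewrite /ratfun_poly rmorphB !rmorphM rmorphB !rmorphM /= mulNr.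
Qed.

Lemma ratfun_map_monoid_morphism : monoid_morphism (ratfun_map i).
Proof.
split=> [|u u'].
  have -> : 1 = ratfun_poly (1 : {poly k}) / ratfun_poly 1.
    by rewrite /ratfun_poly rmorph1 divr1.
  by rewrite ratfun_map_frac ?oner_eq0 // !rmorph1 /ratfun_poly rmorph1 divr1.
have [p [q [_ q0 ->]]] := ratfun_coprime u.
have [p' [q' [_ q'0 ->]]] := ratfun_coprime u'.
rewrite mulf_div -!(rmorphM (@FracField.tofrac _)) !ratfun_map_frac ?mulf_neq0 //.
by rewrite mulf_div !rmorphM /= -!(rmorphM (@FracField.tofrac _)).
Qed.

HB.instance Definition _ :=
  GRing.isZmodMorphism.Build (ratfun k) (ratfun L) (ratfun_map i)
    ratfun_map_zmod_morphism.
HB.instance Definition _ :=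
  GRing.isMonoidMorphism.Build (ratfun k) (ratfun L) (ratfun_map i)
    ratfun_map_monoid_morphism.

Lemma ratfun_map_poly (p : {poly k}) :
  ratfun_map i (ratfun_poly p) = ratfun_poly (map_poly i p).
Proof.
have := ratfun_map_frac i p (oner_neq0 _).
by rewrite /ratfun_poly !rmorph1 !divr1.
Qed.

Lemma ratfun_map_const (c : k) :
  ratfun_map i (ratfun_const c) = ratfun_const (i c).
Proof. by rewrite /ratfun_const ratfun_map_poly map_polyC. Qed.

End RationalFunctions.

Lemma ratfun_map_id (k : fieldType) (u : ratfun k) : ratfun_map idfun u = u.
Proof.
have [p [q [_ q0 ->]]] := ratfun_coprime u.
by rewrite ratfun_map_frac // !map_poly_id.
Qed.

Lemma val_min (L : fieldType) (G : oagType) (v : valuation L G) (s : seq L) u :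
  u \in s -> exists2 m, m \in s & forall c, c \in s -> vle (v m) (v c).
Proof.
elim: s u => // c s IHs u _; have [->|s0] := eqVneq s [::].
  by exists c => [|d]; rewrite inE // => /eqP ->; exact: vle_refl.
have [d ds] : exists d, d \in s by case: (s) s0 => // d r _; exists d; rewrite mem_head.
have [m ms mmin] := IHs d ds.
have [mc|cm] := orP (vle_total (v m) (v c)).
  exists m; first by rewrite inE ms orbT.
  by move=> e; rewrite inE => /predU1P[->|/mmin].
exists c; first by rewrite mem_head.
move=> e; rewrite inE => /predU1P[->|/mmin me]; first exact: vle_refl.
exact: vle_trans me.
Qed.

Section CoarsePlace.
Variables (G : oagType) (Kbar Om : closedFieldType).
Variables (j : {rmorphism ratfun Kbar -> Om}) (w : valuation Om G).

Definition const : {rmorphism Kbar -> Om} :=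
  j \o (@FracField.tofrac {poly Kbar} \o polyC).

(** Evaluation at the variable x: a polynomial read as an element of [Om]. *)
Definition eval : {rmorphism {poly Kbar} -> Om} :=
  j \o @FracField.tofrac {poly Kbar}.

Lemma evalE p : j (ratfun_poly p) = eval p. Proof. by []. Qed.

Lemma evalC c : eval c%:P = const c. Proof. by []. Qed.

(* For the coarsening of w by the value group of Kbar, z is infinitesimal if it
   lies in the maximal ideal, and finite if it lies in the valuation ring. *)
Definition infinitesimal (z : Om) : Prop :=
  forall c, c != 0 -> vlt (w (const c)) (w z).

Definition finite (z : Om) : Prop :=
  exists2 c, c != 0 & vle (w (const c)) (w z).

Lemma const_neq0 c : c != 0 -> const c != 0.
Proof. by rewrite fmorph_eq0. Qed.

Lemma infinitesimal0 : infinitesimal 0.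
Proof.
by move=> c c0; rewrite val0 /vlt vle_None andbT val_eqNone const_neq0.
Qed.

Lemma infinitesimalD z z' : infinitesimal z -> infinitesimal z' -> infinitesimal (z + z').
Proof. by move=> zi z'i c c0; apply: valD_gt; [exact: zi|exact: z'i]. Qed.

Lemma infinitesimalN z : infinitesimal z -> infinitesimal (- z).
Proof. by move=> zi c c0; rewrite valN; exact: zi. Qed.

Lemma infinitesimalB z z' : infinitesimal z -> infinitesimal z' -> infinitesimal (z - z').
Proof. by move=> zi z'i; apply: infinitesimalD => //; exact: infinitesimalN. Qed.

Lemma infinitesimal_distC z z' : infinitesimal (z - z') -> infinitesimal (z' - z).
Proof. by move=> /infinitesimalN; rewrite opprB. Qed.

Lemma infinitesimal_trans z z' z'' :
  infinitesimal (z - z') -> infinitesimal (z' - z'') -> infinitesimal (z - z'').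
Proof. by move=> zz' /(infinitesimalD zz'); rewrite addrA subrK. Qed.

Lemma infinitesimal_le z z' : vle (w z) (w z') -> infinitesimal z -> infinitesimal z'.
Proof. by move=> zz' zi c /zi; move/vlt_le_trans; exact. Qed.

Lemma infinitesimal_const c : infinitesimal (const c) -> c = 0.
Proof. by move=> ci; apply/eqP; apply: contraT => /ci; rewrite vltxx. Qed.

Lemma infinitesimalM z u : infinitesimal z -> finite u -> infinitesimal (z * u).
Proof.
move=> zi [d d0 du] c c0.
have -> : const c = const (c / d) * const d by rewrite -rmorphM divfK.
apply: vlt_mul => //; last exact: const_neq0.
by apply: zi; rewrite mulf_neq0 ?invr_eq0.
Qed.

Lemma not_infinitesimal z : ~ infinitesimal z ->
  exists2 c, c != 0 & vle (w z) (w (const c)).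
Proof.
move=> /existsNP[c /not_implyP[c0 /negP]]; rewrite vltNge negbK.
by exists c.
Qed.

Lemma infinitesimal_mul z z' :
  infinitesimal (z * z') -> infinitesimal z \/ infinitesimal z'.
Proof.
move=> zz'; have [|/not_infinitesimal[c c0 zc]] := pselect (infinitesimal z).
  by left.
right=> d d0; rewrite vltNge; apply/negP => z'd.
have := vle_mul zc z'd; rewrite vleNgt -rmorphM zz' //.
by rewrite mulf_neq0.
Qed.

Lemma infinitesimal_prod (I : eqType) (s : seq I) (f : I -> Om) :
  infinitesimal (\prod_(c <- s) f c) -> exists2 c, c \in s & infinitesimal (f c).
Proof.
elim: s => [|c s IHs].
  rewrite big_nil -(rmorph1 const) => /infinitesimal_const/eqP.
  by rewrite oner_eq0.
rewrite big_cons => /infinitesimal_mul[ci|/IHs[d ds di]].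
  by exists c; rewrite ?mem_head.
by exists d; rewrite // inE ds orbT.
Qed.

Lemma finite_ring z : z \in in_valuation_ring w -> finite z.
Proof. by rewrite in_ringE => z1; exists 1; rewrite ?oner_neq0 ?rmorph1. Qed.

Lemma finite_const c : finite (const c).
Proof.
have [->|c0] := eqVneq c 0; last by exists c => //; exact: vle_refl.
by exists 1; rewrite ?oner_neq0 // rmorph0 val0 vle_None.
Qed.

Lemma infinitesimal_ring z : infinitesimal z -> z \in in_valuation_ring w.
Proof. by move=> zi; rewrite in_ringE vltW // -(rmorph1 const) zi ?oner_neq0. Qed.

Lemma infinitesimal_finite z : infinitesimal z -> finite z.
Proof. by move=> /infinitesimal_ring/finite_ring. Qed.

Lemma finiteD z z' : finite z -> finite z' -> finite (z + z').
Proof.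
move=> [c c0 cz] [d d0 dz'].
have [cd|dc] := orP (vle_total (w (const c)) (w (const d))).
  by exists c => //; apply: valD_ge => //; exact: vle_trans dz'.
by exists d => //; apply: valD_ge => //; exact: vle_trans cz.
Qed.

Lemma finiteM z z' : finite z -> finite z' -> finite (z * z').
Proof.
move=> [c c0 cz] [d d0 dz']; exists (c * d); rewrite ?mulf_neq0 //.
by rewrite rmorphM; exact: vle_mul.
Qed.

Lemma finite_inv z : z != 0 -> ~ infinitesimal z -> finite z^-1.
Proof.
move=> z0 /not_infinitesimal[c c0 zc]; exists c^-1; first by rewrite invr_eq0.
by rewrite fmorphV vleNgt vlt_inv ?const_neq0 // -vleNgt.
Qed.

Lemma finite_close z z' : finite z -> infinitesimal (z - z') -> finite z'.
Proof.
move=> zf /infinitesimal_distC/infinitesimal_finite zz'.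
by have := finiteD zf zz'; rewrite addrC subrK.
Qed.

Lemma infinitesimal_close z z' :
  infinitesimal z -> infinitesimal (z - z') -> infinitesimal z'.
Proof. by move=> zi /infinitesimal_distC /infinitesimalD/(_ zi); rewrite subrK. Qed.

Lemma infinitesimal_congrM z z' u u' : finite z -> finite u' ->
  infinitesimal (z - z') -> infinitesimal (u - u') ->
  infinitesimal (z * u - z' * u').
Proof.
move=> zf u'f zz' uu'; have -> : z * u - z' * u' = (u - u') * z + (z - z') * u'.
  by rewrite mulrBl mulrBl [u * z]mulrC [u' * z]mulrC addrA subrK.
by apply: infinitesimalD; exact: infinitesimalM.
Qed.

Variable a : Kbar.
Hypothesis xa_inf : infinitesimal (eval ('X - a%:P)).

Lemma finite_eval p : finite (eval p).
Proof.
have xf : finite (eval 'X).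
  rewrite -['X](subrK a%:P) rmorphD evalC; apply: finiteD (finite_const _).
  exact: infinitesimal_finite.
elim/poly_ind: p => [|p c IHp].
  by rewrite -polyC0 evalC; exact: finite_const.
rewrite rmorphD rmorphM evalC; apply: finiteD (finite_const _).
exact: finiteM.
Qed.

(** The place sends x to [a], because x - a divides p(x) - p(a) with a finite cofactor. *)
Lemma infinitesimal_eval p : infinitesimal (eval p - const p.[a]).
Proof.
have /factor_theorem[q pE] : root (p - (p.[a])%:P) a by rewrite /root !hornerE subrr.
rewrite -evalC -rmorphB pE rmorphM mulrC; apply: infinitesimalM => //.
exact: finite_eval.
Qed.

Lemma infinitesimal_eval_root p : infinitesimal (eval p) <-> root p a.
Proof.
split=> [pi|/eqP pa0].
  by apply/eqP/infinitesimal_const/(infinitesimal_close pi)/infinitesimal_eval.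
by have := infinitesimal_eval p; rewrite pa0 rmorph0 subr0.
Qed.

Lemma eval_neq0 p : ~~ root p a -> eval p != 0.
Proof.
by apply: contraNneq => p0; apply/infinitesimal_eval_root; rewrite p0; exact: infinitesimal0.
Qed.

(** If q(a) = 0, then p(a) is nonzero by coprimality, whereas p = q (p/q) would be infinitesimal. *)
Lemma denominator_eval (k : fieldType) (f : {rmorphism k -> Kbar}) (p q : {poly k}) :
  coprimep p q -> finite (eval (map_poly f p) / eval (map_poly f q)) ->
  q != 0 -> ~~ root (map_poly f q) a.
Proof.
move=> pq pqf q0; apply/negP => qa.
have pa : ~~ root (map_poly f p) a.
  apply: contraTN qa; rewrite -(coprimep_map f) in pq.
  exact: (coprimep_root pq).
move/negP: pa; apply; apply/infinitesimal_eval_root.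
have eq0 : eval (map_poly f q) != 0.
  by rewrite fmorph_eq0 tofrac_eq0 map_poly_eq0.
rewrite -[eval (map_poly f p)](divfK eq0) mulrC; apply: infinitesimalM pqf.
exact/infinitesimal_eval_root.
Qed.

Lemma ratfun_residue (k : fieldType) (f : {rmorphism k -> Kbar}) (c0 : k)
    (u : ratfun k) :
  f c0 = a -> finite (j (ratfun_map f u)) ->
  exists c, infinitesimal (j (ratfun_map f u) - const (f c)).
Proof.
move=> fc0; have [p [q [pq q0 ->]]] := ratfun_coprime u.
rewrite ratfun_map_frac // fmorph_div !evalE => pqf.
have qa := denominator_eval pq pqf q0.
(* The residue of p/q is p(a)/q(a), which lies in the image of [k] since [a] does. *)
exists (p.[c0] / q.[c0]); rewrite !fmorph_div.
have ra r : f r.[c0] = (map_poly f r).[a] by rewrite -fc0 horner_map.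
rewrite !ra.
have c_neq0 : const (map_poly f q).[a] != 0 by rewrite const_neq0.
have e_neq0 := eval_neq0 qa.
rewrite -mulNr addf_div // mulNr; apply: infinitesimalM.
  apply: (@infinitesimal_trans _ (const (map_poly f p).[a] * const (map_poly f q).[a])).
    rewrite -mulrBl; apply: infinitesimalM (finite_const _).
    exact: infinitesimal_eval.
  rewrite -mulrBr mulrC; apply: infinitesimalM (finite_const _).
  exact/infinitesimal_distC/infinitesimal_eval.
apply: finite_inv; first by rewrite mulf_neq0.
move=> /infinitesimal_mul[/infinitesimal_eval_root|/infinitesimal_const]; first exact/negP.
exact/eqP.
Qed.

Lemma ratfun_residue_const (k : fieldType) (f : {rmorphism k -> Kbar}) (c0 : k)
    (u : ratfun k) (y : Kbar) :
  f c0 = a -> infinitesimal (const y - j (ratfun_map f u)) -> range f y.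
Proof.
move=> fc0 yu; have [|c uc] := ratfun_residue (u := u) fc0.
  exact: finite_close (finite_const y) yu.
exists c => //; apply/eqP; rewrite eq_sym -subr_eq0; apply/eqP/infinitesimal_const.
by rewrite rmorphB; exact: infinitesimal_trans uc.
Qed.

(** The place is discrete on Kbar(x): an infinitesimal quotient has a numerator divisible by x - a,
    and the constant [c] makes up for the finite cofactor. *)
Lemma infinitesimal_ratfun (u : ratfun Kbar) : infinitesimal (j u) ->
  exists2 c, c != 0 & vle (w (eval ('X - a%:P))) (w (const c * j u)).
Proof.
have [p [q [pq q0 ->]]] := ratfun_coprime u.
rewrite fmorph_div !evalE => ui.
have uf := infinitesimal_finite ui.
have qa : ~~ root q a.
  have idE (r : {poly Kbar}) : map_poly idfun r = r by exact: map_poly_id.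
  by have := @denominator_eval Kbar idfun p q pq; rewrite !idE; apply.
have eq0 := eval_neq0 qa.
have /factor_theorem[r pE] : root p a.
  apply/infinitesimal_eval_root; rewrite -(divfK eq0 (eval p)).
  exact: infinitesimalM (finite_eval _).
have [d d0 dr] : finite (eval r / eval q).
  apply: finiteM (finite_eval _) _; apply: finite_inv => //.
  by move/infinitesimal_eval_root; exact/negP.
exists d^-1; first by rewrite invr_eq0.
have -> : const d^-1 * (eval p / eval q) =
    eval ('X - a%:P) * (eval r / eval q / const d).
  by rewrite pE rmorphM fmorphV [eval r * _]mulrC [LHS]mulrC !mulrA.
apply: vle_mul_ring; rewrite in_ringE -(divff (const_neq0 d0)).
by rewrite vle_mul2r // invr_eq0 const_neq0.
Qed.

Hypothesis Om_alg : is_algebraic j.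

(** An equation of [z] is divided by a coefficient of least value. *)
Lemma primitive_polynomial (z : Om) :
  exists p : {poly ratfun Kbar}, [/\ root (map_poly j p) z,
    forall n, j p`_n \in in_valuation_ring w & exists n, p`_n = 1].
Proof.
have [p p0 pz] := Om_alg z.
have lp : j (lead_coef p) \in map j p.
  by apply: map_f; rewrite lead_coefE mem_nth // prednK ?size_poly_gt0.
have [_ /mapP[m mp ->] m_min] := val_min w lp.
have m0 : m != 0.
  apply/eqP => m0; have := m_min _ lp; rewrite m0 rmorph0 val0.
  have [|g ->] := @val_neq0 _ _ w (j (lead_coef p)) => //.
  by rewrite fmorph_eq0 lead_coef_eq0.
exists (m^-1 *: p); split.
- by rewrite map_polyZ /root hornerZ (rootP pz) mulr0.
- move=> n; rewrite coefZ in_ringE rmorphM -[X in vle (w X)](rmorph1 j) -(mulVf m0).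
  rewrite rmorphM vle_mul2l ?fmorph_eq0 ?invr_eq0 //.
  have [np|np] := ltnP n (size p); first by apply: m_min; apply: map_f; rewrite mem_nth.
  by rewrite nth_default // rmorph0 val0 vle_None.
- have /(nthP 0)[n np mE] := mp.
  by exists n; rewrite coefZ mE mulVf.
Qed.

Lemma ratfun_residue_id (u : ratfun Kbar) :
  j u \in in_valuation_ring w -> exists c, infinitesimal (j u - const c).
Proof.
move=> /finite_ring uf; have := @ratfun_residue Kbar idfun a u erefl.
by rewrite ratfun_map_id; apply.
Qed.

(** Replacing the coefficients of a primitive equation of [z] by their residues gives [q] over
    [Kbar] with q(z) infinitesimal. As [q] splits over [Kbar], one factor z - c is infinitesimal. *)
Lemma residue (z : Om) : z \in in_valuation_ring w ->
  exists c, infinitesimal (z - const c).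
Proof.
move=> zO; have [p [pz pO [m pm]]] := primitive_polynomial z.
have zf : finite z by exact: finite_ring.
have zXf n : finite (z ^+ n) by apply: finite_ring; exact: rpredX.
have pc n : exists c, infinitesimal (j p`_n - const c) by exact: ratfun_residue_id.
pose e n := xget 0 [set c | infinitesimal (j p`_n - const c)].
have eP n : infinitesimal (j p`_n - const (e n)).
  by have [c cP] := pc n; rewrite /e; case: xgetP => [_ -> //|/(_ c)].
have mp : (m < size p)%N.
  by rewrite ltnNge; apply/negP => /(nth_default 0); rewrite pm => /eqP; rewrite oner_eq0.
pose q := \poly_(n < size p) e n.
(* The coefficient 1 of the primitive polynomial has residue 1. *)
have q0 : q != 0.
  apply: contraTneq mp => q0; apply/negP => mp.
  have := congr1 (fun r : {poly Kbar} => r`_m) q0; rewrite coef_poly mp coef0 => em.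
  have := eP m; rewrite pm em rmorph0 rmorph1 subr0 -(rmorph1 const).
  by move/infinitesimal_const/eqP; rewrite oner_eq0.
have qz : infinitesimal (map_poly const q).[z].
  have -> : (map_poly const q).[z] =
      - \sum_(n < size p) (j p`_n - const (e n)) * z ^+ n.
    apply/eqP; rewrite -addr_eq0 -[X in _ == X](rootP pz).
    rewrite (@horner_coef_wide _ (size p)); last first.
      by rewrite size_map_poly; exact: size_poly.
    rewrite [X in _ == X](@horner_coef_wide _ (size p)) ?size_map_poly //.
    rewrite -big_split; apply/eqP/eq_bigr => n _ /=.
    by rewrite !coef_map coef_poly ltn_ord /= mulrBl addrC subrK.
  apply: infinitesimalN; apply: big_ind => [||n _]; first exact: infinitesimal0.
    exact: infinitesimalD.
  exact: infinitesimalM.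
have [r qE] := closed_field_poly_normal q.
move: qz; rewrite qE map_polyZ hornerZ => /infinitesimal_mul[/infinitesimal_const/eqP|].
  by rewrite lead_coef_eq0 (negPf q0).
rewrite rmorph_prod horner_prod => /infinitesimal_prod[c _].
rewrite rmorphB /= map_polyX map_polyC !hornerE; by exists c.
Qed.

(** The place has rank one on [Om]. With [m] the first index whose coefficient is not infinitesimal,
    the term of index [m] in the equation of [d] must be balanced by an earlier one, whose
    coefficient is an infinitesimal of Kbar(x) and so comparable with x - a. *)
Lemma infinitesimal_cofinal_xa (d : Om) : infinitesimal d ->
  exists n, vlt (w (eval ('X - a%:P))) (w (d ^+ n)).
Proof.
move=> di; have [p [pd pO [m0 pm0]]] := primitive_polynomial d.
have dO := infinitesimal_ring di.
have d1 : vlt (w 1) (w d) by rewrite -(rmorph1 const) di ?oner_neq0.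
pose P n := `[< ~ infinitesimal (j p`_n) >].
have exP : exists n, P n.
  exists m0; apply/asboolP; rewrite pm0 rmorph1 -(rmorph1 const).
  by move=> /infinitesimal_const/eqP; rewrite oner_eq0.
have [m /asboolP pm m_min] := ex_minnP exP.
have pi n : (n < m)%N -> infinitesimal (j p`_n).
  move=> nm; apply: contrapT => /asboolP/m_min; by rewrite leqNgt nm.
have [c c0 pc] := not_infinitesimal pm.
have mp : (m < size p)%N.
  rewrite ltnNge; apply/negP => pm'; apply: pm; rewrite nth_default // rmorph0.
  exact: infinitesimal0.
have [d0|d_neq0] := eqVneq d 0.
  exists 1%N; rewrite d0 expr1 val0 /vlt vle_None andbT val_eqNone.
  by rewrite fmorph_eq0 tofrac_eq0 polyXsubC_eq0.
have pmd : vlt (w (j p`_m * d ^+ m)) (w (d ^+ m.+1)) .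
  rewrite exprS; apply: vlt_mul; last by rewrite expf_neq0.
    by apply: vle_lt_trans pc _; exact: di.
  exact: vle_refl.
have tail_big n : (m < n)%N -> vlt (w (j p`_m * d ^+ m)) (w (j p`_n * d ^+ n)).
  move=> mn; apply: vlt_le_trans pmd _.
  rewrite -[d ^+ m.+1]mul1r; apply: vle_mul; first by rewrite -in_ringE.
  by rewrite -(subnKC mn) exprD; apply: vle_mul_ring; exact: rpredX.
have pmd0 : j p`_m * d ^+ m != 0 by exact: (vlt_neq0 pmd).
have [n nm npm] : exists2 n, (n < m)%N & vle (w (j p`_n * d ^+ n)) (w (j p`_m * d ^+ m)).
  apply: contrapT => noN.
  have small (n : 'I_(size p)) : (n : nat) != m ->
      vlt (w (j p`_m * d ^+ m)) (w (j p`_n * d ^+ n)).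
    rewrite neq_ltn => /orP[nm|/tail_big //]; rewrite vltNge; apply/negP => le_nm.
    by apply: noN; exists n.
  have := rootP pd; rewrite horner_coef size_map_poly (bigD1 (Ordinal mp)) //= coef_map /=.
  move/eqP; rewrite addr_eq0 => /eqP/(congr1 w); rewrite valN => h.
  have := @vlt_sum _ _ w _ (index_enum 'I_(size p)) (fun n => n != Ordinal mp)
    (fun n : 'I_(size p) => (map_poly j p)`_n * d ^+ n) _ pmd0.
  rewrite -h vltxx => S; suff: false by [].
  by apply: S => n _ nm; rewrite coef_map /=; apply: small.
have [c' c'0 xc'] := infinitesimal_ratfun (pi n nm).
(* Beyond d^m, one factor [d] outweighs the coefficient of index [m] and another the constant
   [c']. *)
exists m.+2; apply: vle_lt_trans xc' _.
rewrite exprS; apply: vlt_mul => //; first exact: di.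
  apply: vle_trans (vltW pmd); apply: vle_trans npm.
  by apply: vle_mul_ring; exact: rpredX.
apply/eqP => pn0; have := pi n nm; move: npm; rewrite pn0 mul0r val0.
by have [g ->] := val_neq0 w pmd0.
Qed.

End CoarsePlace.

(** * Topological closure and Hensel roots *)

Section Closure.
Variables (L : fieldType) (G : oagType) (w : valuation L G).

(** Precision is measured by values of nonzero elements [t] of the field, not by all of [G], which
    may be larger than the value group. *)
Definition val_closure (F : set L) : set L :=
  [set z | forall t, t != 0 -> exists2 e, F e & vlt (w t) (w (z - e))].

Lemma vlt_val0 t : t != 0 -> vlt (w t) (w 0).
Proof. by move=> t0; rewrite val0 /vlt vle_None andbT val_eqNone. Qed.

Lemma sub_val_closure F : F `<=` val_closure F.
Proof. by move=> u Fu t t0; exists u => //; rewrite subrr; exact: vlt_val0. Qed.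

Lemma val_closureK F : val_closure (val_closure F) `<=` val_closure F.
Proof.
move=> z zF t t0; have [e eF ze] := zF t t0; have [e' Fe' ee'] := eF t t0.
by exists e' => //; rewrite -(subrK e z) -addrA; exact: valD_gt.
Qed.

Variables (F : set L) (HF : is_subfield F).

Lemma val_closure_mul z z' :
  val_closure F z -> val_closure F z' -> val_closure F (z * z').
Proof.
move=> zF z'F t t0.
have approx c y : val_closure F y ->
    exists2 e, F e & vlt (w t) (w (c * (y - e))).
  move=> yF; have [->|c0] := eqVneq c 0.
    by exists 0; [exact: subfield0|rewrite mul0r; exact: vlt_val0].
  have [|e Fe ye] := yF (t / c); first by rewrite mulf_neq0 ?invr_eq0.
  exists e => //; rewrite mulrC.
  by rewrite -[t](divfK c0) vlt_mul2r.
have [e' Fe' ze'] := approx z z' z'F; have [e Fe ez'] := approx e' z zF.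
exists (e * e'); first exact: subfieldM.
have -> : z * z' - e * e' = z * (z' - e') + e' * (z - e).
  by rewrite !mulrBr addrA [e' * z]mulrC subrK [e' * e]mulrC.
exact: valD_gt.
Qed.

Lemma val_closure_inv z : val_closure F z -> val_closure F z^-1.
Proof.
move=> zF; have [->|z0] := eqVneq z 0.
  by rewrite invr0; apply: sub_val_closure; exact: subfield0.
move=> t t0; have tz0 : t * z * z != 0 by rewrite !mulf_neq0.
(* The first bound forces w e = w z; with it, the second makes 1/z - 1/e = (e - z)/(ze) smaller than
   [t]. *)
have [e Fe [ze tze]] : exists2 e, F e & vlt (w z) (w (z - e)) /\
    vlt (w (t * z * z)) (w (z - e)).
  have [le|le] := orP (vle_total (w z) (w (t * z * z))).
    have [e Fe ze] := zF _ tz0; exists e => //; split=> //.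
    exact: vle_lt_trans ze.
  have [e Fe ze] := zF _ z0; exists e => //; split=> //.
  exact: vle_lt_trans ze.
have we := val_close ze.
have e0 : e != 0 by rewrite -(val_eqNone w) we val_eqNone.
exists e^-1; first exact: subfieldV.
rewrite -(vlt_mul2r w (c := z * e)) ?mulf_neq0 // mulrBl mulKf // [e^-1 * _]mulrCA mulVf // mulr1.
by rewrite val_distC mulrA Defs.valM we -Defs.valM.
Qed.

Lemma val_closure_subfield : is_subfield (val_closure F).
Proof.
apply/is_subfieldP; split=> [|z z' zF z'F t t0|z z' zF z'F].
- by apply: sub_val_closure; exact: subfield1.
- have [e Fe ze] := zF t t0; have [e' Fe' ze'] := z'F t t0.
  exists (e - e'); first exact: subfieldB.
  have -> : z - z' - (e - e') = (z - e) - (z' - e').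
    by rewrite !opprB addrACA [RHS]addrACA; congr (_ + _); rewrite addrC.
  exact: valB_gt.
- by apply: val_closure_mul => //; exact: val_closure_inv.
Qed.

(** The root [u] exists beforehand and Newton's iteration only approximates it, so closedness of [F]
    replaces completeness. *)
Lemma newton (s : seq L) (u u0 : L) :
  val_closure F `<=` F ->
  (forall n, F (\prod_(c <- u :: s) ('X - c%:P))`_n) -> F u0 ->
  (forall c, c \in u :: s -> c \in in_valuation_ring w) ->
  (forall c, c \in s -> w (u0 - c) = w 1) ->
  vlt (w 1) (w (u - u0)) ->
  (forall z, z != 0 -> exists n, vlt (w z) (w ((u - u0) ^+ n))) ->
  F u.
Proof.
move=> Fcl Fh Fu0 sO u0s uu0 cofinal.
pose k := \prod_(c <- s) ('X - c%:P); pose h := ('X - u%:P) * k.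
have hE : h = \prod_(c <- u :: s) ('X - c%:P) by rewrite big_cons.
have kO : k \is a polyOver (in_valuation_ring w).
  rewrite /k big_seq; apply: rpred_prod => c cs.
  by rewrite polyOverXsubC sO // inE cs orbT.
set d := u - u0 in uu0 cofinal *.
(* One more factor [d] per step is enough, since the powers of [d] are assumed cofinal. *)
have step n : exists2 e, F e & vle (w (d ^+ n.+1)) (w (u - e)).
  elim: n => [|n [e Fe ue]]; first by exists u0; rewrite // expr1 vle_refl.
  have dO : d \in in_valuation_ring w by rewrite in_ringE vltW.
  have d_e : vle (w d) (w (u - e)).
    by apply: vle_trans ue; rewrite exprS; apply: vle_mul_ring; exact: rpredX.
  have ue1 : vlt (w 1) (w (u - e)) by exact: vlt_le_trans d_e.
  have eO : e \in in_valuation_ring w.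
    have ueO : u - e \in in_valuation_ring w by rewrite in_ringE; exact: vltW.
    by have := rpredB (sO u (mem_head _ _)) ueO; rewrite subKr.
  have ke : w k.[e] = w 1.
    rewrite -(expr1n _ (size s)) /k horner_prod -(big_map (fun c => ('X - c%:P).[e]) xpredT id).
    rewrite -(size_map (fun c => ('X - c%:P).[e])); apply: val_prod_const.
    move=> _ /mapP[c cs ->]; rewrite !hornerE.
    have -> : e - c = (u0 - c) + ((u - u0) - (u - e)).
      by ring.
    rewrite -(u0s c cs); apply: valD_lt; rewrite u0s //; exact: valB_gt.
  have k'O : k^`().[e] \in in_valuation_ring w.
    by rewrite rpred_horner // polyOver_deriv.
  have h'E : h^`().[e] = k.[e] + (e - u) * k^`().[e].
    by rewrite derivM derivXsubC mul1r !hornerE.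
  have h'1 : w h^`().[e] = w 1.
    rewrite h'E -ke; apply: valD_lt; rewrite ke.
    apply: vlt_le_trans (vle_mul_ring _ k'O); by rewrite val_distC.
  have h'0 : h^`().[e] != 0 by rewrite -(val_eqNone w) h'1 val_eqNone oner_eq0.
  exists (e - h.[e] / h^`().[e]).
    apply: subfieldB => //; apply: subfield_div => //; apply: subfield_horner => //.
      by move=> m; rewrite hE.
    move=> m; rewrite coef_deriv -mulr_natl hE; apply: subfieldM => //.
    exact: subfield_nat.
  (* The new error is the square of the old one times k'(e)/h'(e), where h'(e) is a unit because the
     other roots stay at distance of value 0. *)
  have -> : u - (e - h.[e] / h^`().[e]) =
      - ((u - e) * (u - e) * (k^`().[e] / h^`().[e])).
    have hE' : h.[e] = (e - u) * k.[e] by rewrite hornerM !hornerE.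
    have -> : u - (e - h.[e] / h^`().[e]) =
        (h^`().[e] * (u - e) + h.[e]) / h^`().[e] by field.
    rewrite h'E hE'; field; rewrite -h'E; exact: h'0.
  rewrite valN; apply: vle_trans (vle_mul_ring _ _); last first.
    by rewrite in_ringE -(divff h'0) vle_mul2r ?invr_eq0 // h'1 -in_ringE.
  by rewrite exprSr; exact: vle_mul.
apply: Fcl => t t0; have [n tn] := cofinal t t0; have [e Fe ue] := step n.
exists e => //; apply: vlt_le_trans tn _; apply: vle_trans ue.
by rewrite exprSr; apply: vle_mul_ring; rewrite in_ringE vltW.
Qed.

End Closure.

(** * From liftable roots to invariance of the valuation *)

Section HenselInvariance.
Variables (Om : closedFieldType) (G : oagType) (w : valuation Om G).
Variables (N : set Om).
Hypotheses (HN : is_subfield N) (N_alg : forall y, algebraic_over N y).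

(* The product P of the conjugates of r of minimal value has larger value than
   its other conjugates, so that P divided by the sum of all conjugates of P
   is a root in 1 + M_w of a polynomial whose other roots are in M_w. *)
Lemma hensel_invariant :
  (forall u, vlt (w 1) (w (u - 1)) ->
     (forall t, fixes N t -> t u = u \/ vlt (w 1) (w (t u))) ->
     fixed_field N u) ->
  forall t r, fixes N t -> w (t r) = w r.
Proof.
move=> hensel t r tN; have [->|r0] := eqVneq r 0; first by rewrite rmorph0.
have [s [us rs sP ts]] := orbitP N_alg r.
have [m ms m_min] := val_min w rs.
have m0 : m != 0 by have [h _ ->] := (sP m).1 ms; rewrite fmorph_eq0.
pose I0 := [seq c <- s | w c == w m].
have I0P c : (c \in I0) = (w c == w m) && (c \in s) by rewrite mem_filter.
pose P := \prod_(c <- I0) c.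
have wP : w P = w (m ^+ size I0).
  by apply: val_prod_const => c; rewrite I0P => /andP[/eqP].
have P0 : P != 0 by rewrite -(val_eqNone w) wP val_eqNone expf_neq0.
have uI0 : uniq I0 by rewrite filter_uniq.
have hPE (h : {rmorphism Om -> Om}) : h P = \prod_(c <- map h I0) c by rewrite rmorph_prod big_map.
have hP_stable (h : {rmorphism Om -> Om}) : (forall c, c \in I0 -> h c \in I0) -> h P = P.
  by move=> hI0; rewrite hPE; apply: perm_big; exact: stable_perm.
have hP (h : {rmorphism Om -> Om}) : fixes N h -> ~ (forall c, c \in I0 -> h c \in I0) -> vlt (w P) (w (h P)).
  move=> hN /existsNP[c /not_implyP[cI0 hc]]; rewrite wP hPE -(size_map h).
  have hI0s d : d \in I0 -> h d \in s by rewrite I0P => /andP[_ ds]; exact: ts.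
  apply: vlt_prod => // [_ /mapP[d /hI0s ds ->]|]; first exact: m_min.
  exists (h c); first exact: map_f.
  rewrite /vlt m_min ?hI0s // andbT eq_sym.
  by apply/negP => /eqP hcm; apply: hc; rewrite I0P hcm eqxx hI0s.
have P_conj (h : {rmorphism Om -> Om}) : fixes N h -> h P = P \/ vlt (w P) (w (h P)).
  move=> hN; have [/hP_stable|] := pselect (forall c, c \in I0 -> h c \in I0).
    by left.
  by right; exact: hP.
have [o [uo Po oP ot]] := orbitP N_alg P.
pose e1 := \sum_(c <- o) c.
have he1 (h : {rmorphism Om -> Om}) : fixes N h -> h e1 = e1.
  move=> hN; rewrite /e1 rmorph_sum -(big_map h xpredT id) /=.
  apply: perm_big; apply: stable_perm => //; exact: ot.
have e1E : e1 = P + \sum_(c <- rem P o) c by rewrite /e1 (big_rem P).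
have rest_big : vlt (w P) (w (\sum_(c <- rem P o) c)).
  apply: vlt_sum => // c; rewrite mem_rem_uniq // !inE => /andP[cP /oP[h hN cE]] _.
  by rewrite cE in cP *; have [hPP|//] := P_conj h hN; rewrite hPP eqxx in cP.
have we1 : w e1 = w P by rewrite e1E; exact: valD_lt.
have e10 : e1 != 0 by rewrite -(val_eqNone w) we1 val_eqNone.
have big_e1 z : vlt (w P) (w z) -> vlt (w 1) (w (z / e1)).
  by move=> Pz; rewrite -(divff e10) vlt_mul2r ?invr_eq0 // we1.
have uN : fixed_field N (P / e1).
  apply: hensel => [|h hN].
    rewrite -{2}(divff e10) -mulrBl; apply: big_e1.
    by rewrite e1E opprD addrA subrr sub0r valN.
  rewrite fmorph_div he1 //; have [->|/big_e1] := P_conj h hN; by [left|right].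
have P_fixed (h : {rmorphism Om -> Om}) : fixes N h -> h P = P.
  by move=> hN; rewrite -[P](divfK e10) rmorphM he1 // uN.
have I0_stable (h : {rmorphism Om -> Om}) : fixes N h -> forall c, c \in I0 -> h c \in I0.
  move=> hN; apply: contrapT => /(hP h hN); rewrite P_fixed // vltxx.
  by [].
(* The element [m] of [I0] is a conjugate of [r] by some [h], and [h] permutes [I0]. *)
have rI0 : r \in I0.
  have [h hN mE] := (sP m).1 ms.
  have : m \in map h I0.
    by rewrite (perm_mem (stable_perm uI0 (I0_stable h hN))) I0P eqxx.
  by move/mapP => [c cI0]; rewrite mE => /fmorph_inj ->.
have := I0_stable t tN r rI0; move: rI0; rewrite !I0P => /andP[/eqP -> _].
by move=> /andP[/eqP].
Qed.

Lemma henselian_of_invariant : fixed_field N `<=` N ->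
  (forall t r, fixes N t -> w (t r) = w r) -> henselian w N.
Proof.
move=> NN w_inv; apply: henselian_conjugates => // z.
have [s [us zs sP ts]] := orbitP N_alg z.
have ws c : c \in s -> w c = w z by move=> /sP[t tN ->]; exact: w_inv.
exists s; split=> // [n|c cs|c cs].
- by apply: NN; exact: fixed_prod_XsubC.
- by rewrite !in_ringE (ws c cs).
- by rewrite (ws c cs).
Qed.

End HenselInvariance.

Lemma fixed_field_of_pow (Om : closedFieldType) (F : set Om) (z : Om) q :
  [pchar Om].-nat q -> F (z ^+ q) -> fixed_field F z.
Proof.
move=> q_nat Fzq t tF; apply/eqP; rewrite -subr_eq0.
have : (t z - z) ^+ q == 0.
  by rewrite exprDn_pchar // exprNn_pchar // -rmorphXn /= tF // subrr.
by rewrite expf_eq0 => /andP[].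
Qed.

(** * Implicit constants *)

Section AlgebraicTower.
Variables (K Kbar Om : fieldType) (i : {rmorphism K -> Kbar}).
Variable j : {rmorphism ratfun Kbar -> Om}.
Hypotheses (Kbar_alg : is_algebraic i) (Om_alg : is_algebraic j).

Definition embed_ratfun : {rmorphism ratfun K -> Om} := j \o ratfun_map i.

Lemma embed_ratfun_const c :
  embed_ratfun (ratfun_const c) = j (ratfun_const (i c)).
Proof. by rewrite /= ratfun_map_const. Qed.

Lemma integral_embed_poly (p : {poly Kbar}) :
  integralOver embed_ratfun (j (ratfun_poly p)).
Proof.
have int_const c : integralOver embed_ratfun (j (ratfun_const c)).
  apply/integral_algebraic; have [q q0 qc] := Kbar_alg c.
  pose f : {rmorphism K -> ratfun K} := @FracField.tofrac {poly K} \o polyC.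
  pose g : {rmorphism Kbar -> Om} := j \o (@FracField.tofrac {poly Kbar} \o polyC).
  exists (map_poly f q); first by rewrite map_poly_eq0.
  have -> : map_poly embed_ratfun (map_poly f q) = map_poly g (map_poly i q).
    by apply/polyP => n; rewrite !coef_map /=; exact: (embed_ratfun_const q`_n).
  by rewrite (fmorph_root g).
elim/poly_ind: p => [|p c IHp].
  by rewrite /ratfun_poly !rmorph0; exact: integral0.
rewrite /ratfun_poly !rmorphD !rmorphM /=; apply: integral_add (int_const c).
apply: integral_mul => //.
have -> : j (FracField.tofrac 'X) = embed_ratfun (ratfun_poly 'X).
  by rewrite /= ratfun_map_poly map_polyX.
exact: integral_id.
Qed.

Lemma algebraic_over_embed (y : Om) : algebraic_over (range embed_ratfun) y.
Proof.
apply/algebraic_over_range/integral_algebraic.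
have [p p0 py] := Om_alg y.
apply: (@integral_root _ _ _ (map_poly j p)) py _; first by rewrite map_poly_eq0.
move=> _ /(nthP 0)[n _ <-]; rewrite coef_map /=.
have [r [q [_ _ ->]]] := ratfun_coprime p`_n.
by rewrite fmorph_div; apply: integral_div; exact: integral_embed_poly.
Qed.

(** In p = c q, comparing leading coefficients shows that [c] is a quotient of elements of [K]. *)
Lemma ratfun_map_eq_const (u : ratfun K) (c : Kbar) :
  ratfun_map i u = ratfun_const c -> range i c.
Proof.
have [p [q [_ q0 ->]]] := ratfun_coprime u; rewrite ratfun_map_frac // => pqc.
have mq0 : ratfun_poly (map_poly i q) != 0 by rewrite tofrac_eq0 map_poly_eq0.
have : map_poly i p = c *: map_poly i q.
  apply/eqP; rewrite -mul_polyC -tofrac_eq rmorphM /=; apply/eqP.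
  by rewrite -[LHS](divfK mq0) -[X in X * _]/(ratfun_poly _ / _) pqc.
move/(congr1 lead_coef); rewrite lead_coefZ !lead_coef_map => pcq.
exists (lead_coef p / lead_coef q) => //.
by rewrite fmorph_div pcq mulfK // fmorph_eq0 lead_coef_eq0.
Qed.

End AlgebraicTower.

Lemma henselian_eq (L : fieldType) (G G' : oagType) (v : valuation L G)
    (v' : valuation L G') (F : set L) :
  in_valuation_ring v =i in_valuation_ring v' -> henselian v F -> henselian v' F.
Proof.
move=> vv' hv H w wF u; rewrite -vv'; apply: hv => // t Ft.
by rewrite vv' wF.
Qed.

(** * A henselian field over E(x) with controlled constants *)

Section ImplicitConstants.
Variables (G : oagType) (Kbar Om : closedFieldType).
Variables (j : {rmorphism ratfun Kbar -> Om}) (w : valuation Om G).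
Hypothesis Om_alg : is_algebraic j.
Variable a : Kbar.
Local Notation const := (const j).
Local Notation eval := (eval j).
Local Notation inf := (infinitesimal j w).
Local Notation xa := (eval ('X - a%:P)).
Hypothesis xa_inf : inf xa.

Lemma xa_neq0 : xa != 0.
Proof. by rewrite fmorph_eq0 tofrac_eq0 polyXsubC_eq0. Qed.

Lemma poly_bounded (p : {poly Kbar}) : p != 0 ->
  exists n, vlt (w (eval p)) (w (xa ^+ n)).
Proof.
move=> p0; have [m [q qa pE]] := multiplicity_XsubC p a.
rewrite p0 /= in qa; exists m.+1; rewrite pE rmorphM rmorphXn exprS.
apply: vlt_mul; last by rewrite expf_neq0 // xa_neq0.
  have [|c c0 qc] := @not_infinitesimal _ _ _ j w (eval q).
    by move/(infinitesimal_eval_root xa_inf); exact/negP.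
  by apply: vle_lt_trans qc _; exact: xa_inf.
exact: vle_refl.
Qed.

Lemma ratfun_bounded (u : ratfun Kbar) : u != 0 ->
  exists n, vlt (w (j u)) (w (xa ^+ n)).
Proof.
have [p [q [_ q0 ->]]] := ratfun_coprime u => pq0.
have p0 : p != 0 by apply: contraNneq pq0 => ->; rewrite /ratfun_poly rmorph0 mul0r.
have [n pn] := poly_bounded p0; exists n.+1.
have eq0 : eval q != 0 by rewrite fmorph_eq0 tofrac_eq0.
have [c c0 cq] := finite_eval xa_inf q.
rewrite fmorph_div !evalE exprSr; apply: vlt_mul => //; last by rewrite invr_eq0.
have cV : vle (w (eval q)^-1) (w (const c)^-1).
  by rewrite vleNgt vlt_inv ?const_neq0 // -vleNgt.
apply: vle_trans cV _; rewrite -fmorphV; apply: vltW; apply: xa_inf.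
by rewrite invr_eq0.
Qed.

(** Once the powers of X are removed from a primitive equation of [z], its nonzero constant term is
    a multiple of [z] in the valuation ring, which reduces the bound to Kbar(x). *)
Lemma bounded (z : Om) : z != 0 -> exists n, vlt (w z) (w (xa ^+ n)).
Proof.
move=> z0; have [zO|zO] := boolP (z \in in_valuation_ring w); last first.
  by exists 0%N; rewrite expr0 vltNge -in_ringE.
have [p [pz pO [n pn]]] := primitive_polynomial w Om_alg z.
have p0 : p != 0.
  by apply: contra_eq_neq pn => ->; rewrite coef0 eq_sym oner_neq0.
have [m [q q0 pE]] := multiplicity_XsubC p 0.
rewrite p0 subr0 /= in q0 pE.
have qz : root (map_poly j q) z.
  move: pz; rewrite pE rmorphM rmorphXn /= map_polyX rootM => /orP[//|].
  by rewrite rootE hornerXn expf_eq0 (negPf z0) andbF.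
have qO k : j q`_k \in in_valuation_ring w.
  by have := pO (k + m)%N; rewrite pE coefMXn ltnNge leq_addl addnK.
have q00 : q`_0 != 0 by rewrite -horner_coef0.
have [k qk] := ratfun_bounded q00; exists k; apply: vle_lt_trans qk.
have sq : size q = (size q).-1.+1.
  rewrite prednK // size_poly_gt0; apply: contraNneq q00 => ->.
  by rewrite coef0.
move/rootP: qz; rewrite horner_coef size_map_poly sq big_ord_recl expr0 mulr1.
rewrite coef_map /= => /eqP; rewrite addr_eq0 => /eqP ->; rewrite valN.
apply: vle_sum => l _; rewrite coef_map /= exprS mulrCA.
by apply: vle_mul_ring; rewrite rpredM // rpredX.
Qed.

Lemma infinitesimal_cofinal (d z : Om) : inf d -> z != 0 ->
  exists n, vlt (w z) (w (d ^+ n)).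
Proof.
move=> di /bounded[n zn]; have [m dm] := infinitesimal_cofinal_xa xa_inf Om_alg di.
exists (m * n)%N; apply: vlt_le_trans zn _; rewrite exprM.
by apply: vle_exp; exact: vltW.
Qed.

Variables (k : fieldType) (f : {rmorphism k -> Kbar}).
Hypotheses (Kbar_alg : is_algebraic f) (fa : range f a).
Hypothesis f_hens : henselian (val_comp w const) (range f).

Let E := range f.
Let Ex := range (embed_ratfun f j).
Let N0 := fixed_field Ex.
Let N := val_closure w N0.

Let HE : is_subfield E. Proof. exact: range_subfield. Qed.
Let HEx : is_subfield Ex. Proof. exact: range_subfield. Qed.
Let HN0 : is_subfield N0. Proof. exact: fixed_field_subfield. Qed.
Let HN : is_subfield N. Proof. exact: val_closure_subfield. Qed.
Let E_alg y : algebraic_over E y.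
Proof. exact/algebraic_over_range. Qed.
Let Ex_alg y : algebraic_over Ex y.
Proof. exact: algebraic_over_embed. Qed.
Let ExN0 : Ex `<=` N0. Proof. exact: sub_fixed_field. Qed.
Let N0N : N0 `<=` N. Proof. exact: sub_val_closure. Qed.
Let N_alg y : algebraic_over N y.
Proof. by apply: algebraic_overS (Ex_alg y); exact: (subset_trans ExN0 N0N). Qed.

(** An element [e] of [N0] within x - a of [z] is infinitesimally close to [y]. Then y^q is close to
    e^q in E(x), hence is a residue of E(x), that is, an element of [E]. *)
Lemma approximate_const (y : Kbar) (z : Om) : N z -> inf (z - const y) ->
  exists q, [pchar Kbar].-nat q /\ E (y ^+ q).
Proof.
move=> Nz zy; have [e N0e ze] := Nz _ xa_neq0.
have [q [q_nat [u _ uE]]] := fixed_field_pow HEx Ex_alg N0e.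
exists q; split; first by rewrite -(eq_pnat _ (fmorph_pchar const)).
have [c0 _ c0a] := fa.
apply: (ratfun_residue_const xa_inf c0a (u := u)).
have -> : j (ratfun_map f u) = e ^+ q by [].
have -> : const (y ^+ q) - e ^+ q = (const y - e) ^+ q.
  by rewrite exprDn_pchar // exprNn_pchar // rmorphXn.
have ye : inf (const y - e).
  apply: infinitesimal_trans (infinitesimal_distC zy) _.
  by apply: infinitesimal_le xa_inf; exact: vltW.
have : (0 < q)%N by case: (q) q_nat.
case: (q) => // n _; rewrite exprS; apply: infinitesimalM => //.
by apply: finite_ring; apply: rpredX; exact: infinitesimal_ring ye.
Qed.

Lemma closure_fixed_field : fixed_field N `<=` N.
Proof.
move=> z zN t t0.
have [q [q_nat Nzq]] := fixed_field_pow HN N_alg zN.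
have q0 : (0 < q)%N by case: (q) q_nat.
(* Precision t^q for z^q becomes precision [t] for [z], since taking q-th powers is additive
   here. *)
have [e N0e ze] := Nzq _ (expf_neq0 q t0).
have /closed_rootP[e' e'E] : size ('X^q - e%:P) != 1%N by rewrite size_XnsubC // -lt0n.
have eE : e = e' ^+ q.
  by move: e'E; rewrite /root !hornerE subr_eq0 => /eqP ->.
exists e'.
  apply: fixed_fieldK; apply: (fixed_field_of_pow q_nat); by rewrite -eE.
move: ze; rewrite eE !vltNge; apply: contraNN => /(vle_exp q).
by rewrite exprDn_pchar // exprNn_pchar.
Qed.

Lemma prod_XsubC_residue (s : seq Om) (r : Om -> Kbar) :
  (forall c, c \in s -> inf (c - const (r c))) ->
  forall n, inf ((\prod_(c <- s) ('X - c%:P))`_n -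
                 const (\prod_(c <- map r s) ('X - c%:P))`_n).
Proof.
elim: s => [_ n|c s IHs sr n].
  rewrite !big_nil !coef1; case: (n == 0%N);
    by rewrite ?rmorph1 ?rmorph0 subrr; exact: infinitesimal0.
have {}IHs := IHs (fun d ds => sr d (mem_behead (ds : d \in behead (c :: s)))).
rewrite map_cons !big_cons !mulrBl !coefB !coefXM !coefCM rmorphB rmorphM.
have subrACA (x y z t : Om) : x - y - (z - t) = (x - z) - (y - t) by ring.
rewrite subrACA.
apply: infinitesimalB.
  by case: n => [|n] /=; [rewrite rmorph0 subrr; exact: infinitesimal0|exact: IHs].
have cr := sr c (mem_head _ _).
apply: infinitesimal_congrM => //; last exact: finite_const.
exact: finite_close (finite_const _ _ _) (infinitesimal_distC cr).
Qed.

(** Hensel's lemma for a composite place: the root is found among the residues in [Kbar], where [E]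
    is henselian, and then lifted by Newton's iteration along the (x - a)-adic place. *)
Lemma closure_hensel (u : Om) : vlt (w 1) (w (u - 1)) ->
  (forall t, fixes N t -> t u = u \/ vlt (w 1) (w (t u))) -> N u.
Proof.
move=> u1 u_conj; have wu : w u = w 1 by apply: val_close; rewrite val_distC.
have [s0 [us0 us0u s0P s0t]] := orbitP N_alg u.
pose s := rem u s0; have s_perm : perm_eq s0 (u :: s) by exact: perm_to_rem.
have sM c : c \in s -> vlt (w 1) (w c).
  rewrite /s mem_rem_uniq // !inE => /andP[cu /s0P[t tN cE]].
  by rewrite cE in cu *; have [tu|//] := u_conj t tN; rewrite tu eqxx in cu.
have sO c : c \in u :: s -> c \in in_valuation_ring w.
  rewrite inE in_ringE => /predU1P[->|/sM/vltW //]; by rewrite wu vle_refl.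
have Nh n : N (\prod_(c <- u :: s) ('X - c%:P))`_n.
  rewrite -(perm_big _ s_perm); apply: closure_fixed_field.
  exact: fixed_prod_XsubC.
pose r c := xget 0 [set d | inf (c - const d)].
have rP c : c \in u :: s -> inf (c - const (r c)).
  move=> /sO /(residue xa_inf Om_alg)[d cd].
  by rewrite /r; case: xgetP => [_ -> //|/(_ d)].
pose h := \prod_(c <- map r (u :: s)) ('X - c%:P).
have Eh n : fixed_field E h`_n.
  have [q [q_nat Eq]] := approximate_const (Nh n) (prod_XsubC_residue rP n).
  exact: fixed_field_of_pow q_nat Eq.
have wr c : c \in u :: s -> vlt (w 1) (w (c - const (r c))).
  by move=> /rP ci; rewrite -(rmorph1 const); apply: ci; exact: oner_neq0.
have wru : w (const (r u)) = w 1.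
  by rewrite -wu; apply: val_close; rewrite wu wr ?mem_head.
(* Automorphisms over [E] permute the roots of [h] and preserve the valuation of [Kbar]; r(u) is a
   unit, while the residues of the other conjugates are in the maximal ideal. *)
have ruE : fixed_field E (r u).
  move=> t tE; have : root h (t (r u)).
    rewrite /root -(fixes_horner (F := fixed_field E)) //; last first.
      by move=> c cE; exact: cE.
    have /eqP -> : root h (r u) by rewrite root_prod_XsubC map_f // mem_head.
    by rewrite rmorph0.
  rewrite root_prod_XsubC => /mapP[c]; rewrite inE => /predU1P[-> //|cs tr].
  have cM : vlt (w 1) (w (const (r c))).
    rewrite -[const (r c)](subKr c); apply: valB_gt; first exact: sM.
    by apply: wr; rewrite inE cs orbT.
  have t_inv := henselian_invariant _ f_hens tE.
  have := invariant_ideal (w := val_comp w const) (r u) t_inv.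
  by rewrite /= rmorph1 tr cM wru vltxx.
have N0r : N0 (const (r u)).
  have [q [q_nat [c _ cE]]] := fixed_field_pow HE E_alg ruE.
  apply: (@fixed_field_of_pow _ _ _ q).
    by rewrite (eq_pnat _ (fmorph_pchar const)).
  by rewrite -rmorphXn -cE; exists (ratfun_const c); rewrite // embed_ratfun_const.
(* Starting from the residue makes the initial error infinitesimal, which is what cofinality of its
   powers needs. *)
apply: (@newton _ _ w N HN s u (const (r u))) => //.
- exact: val_closureK.
- exact: N0N.
- by move=> c cs; rewrite -wru; apply: valD_lt; rewrite valN wru; exact: sM.
- by apply: wr; exact: mem_head.
- by move=> z z0; apply: infinitesimal_cofinal => //; apply: rP; exact: mem_head.
Qed.

Lemma closure_henselian : henselian w N.
Proof.
apply: henselian_of_invariant => //; first exact: closure_fixed_field.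
apply: hensel_invariant => // u u1 u_conj; apply: sub_fixed_field.
exact: closure_hensel.
Qed.

Lemma henselian_over_ratfun :
  exists M : set Om, [/\ is_subfield M, henselian w M,
    range (embed_ratfun f j) `<=` M &
    forall y, M (const y) -> fixed_field (range f) y].
Proof.
exists N; split=> //; first exact: closure_henselian.
  exact: (subset_trans ExN0 N0N).
move=> y Ny; have [|q [q_nat Eq]] := approximate_const (y := y) Ny.
  by rewrite subrr; exact: infinitesimal0.
exact: fixed_field_of_pow q_nat Eq.
Qed.

End ImplicitConstants.

(** * Constants fixed over a henselian extension of K(x) *)

Section OverHenselian.
Variables (G : oagType) (K : fieldType) (Kbar Om : closedFieldType).
Variables (i : {rmorphism K -> Kbar}) (j : {rmorphism ratfun Kbar -> Om}).
Hypotheses (Kbar_alg : is_algebraic i) (Om_alg : is_algebraic j).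
Variable w : valuation Om G.
Local Notation const := (const j).

Let Kx := range (embed_ratfun i j).

Lemma const_base c : Kx (const (i c)).
Proof. by exists (ratfun_const c); rewrite // embed_ratfun_const. Qed.

(** A constant goes to a root of the same polynomial over [K], and this polynomial already splits
    over [Kbar]. *)
Lemma fixes_const (t : {rmorphism Om -> Om}) (F : set Om) y :
  Kx `<=` F -> fixes F t -> exists y', t (const y) = const y'.
Proof.
move=> KxF tF; have [p p0 py] := Kbar_alg y.
have [s pE] := closed_field_poly_normal (map_poly i p).
have : root (map_poly const (map_poly i p)) (t (const y)).
  rewrite /root -(fixes_horner (F := F)) //; last first.
    by move=> n; rewrite !coef_map; apply: KxF; exact: const_base.
  by rewrite horner_map (rootP py) !rmorph0.
rewrite pE map_polyZ rootZ; last first.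
  by rewrite fmorph_eq0 lead_coef_eq0 map_poly_eq0.
rewrite rmorph_prod (eq_bigr (fun c => 'X - (const c)%:P)) => [|c _]; last first.
  by rewrite rmorphB /= map_polyX map_polyC.
rewrite -(big_map const xpredT (fun c => 'X - c%:P)) root_prod_XsubC => /mapP[c _ ->].
by exists c.
Qed.

Lemma conjugates_const (F : set Om) y : is_subfield F -> Kx `<=` F ->
  exists s : seq Kbar, [/\ uniq (map const s), y \in s,
    (forall c, c \in s -> exists2 t, fixes F t & const c = t (const y)) &
    forall t, fixes F t -> forall c, c \in map const s -> t c \in map const s].
Proof.
move=> HF KxF.
have F_alg z : algebraic_over F z.
  by apply: algebraic_overS KxF _; exact: algebraic_over_embed.
have [o [uo yo oP ot]] := orbitP F_alg (const y).
have oK c : c \in o -> exists c', const c' = c.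
  by move=> /oP[t tF ->]; have [c' ->] := fixes_const y KxF tF; exists c'.
have [s oE] : exists s, o = map const s.
  elim: (o) oK => [_|c r IHr rK]; first by exists [::].
  have [s ->] := IHr (fun d dr => rK d (mem_behead (dr : d \in behead (c :: r)))).
  by have [c' <-] := rK c (mem_head _ _); exists (c' :: s).
rewrite {}oE in uo yo oP ot; exists s; split=> //.
  by move: yo; rewrite mem_map //; exact: fmorph_inj.
by move=> c cs; have [t tF ->] := (oP (const c)).1 (map_f _ cs); exists t.
Qed.

Lemma map_prod_const (s : seq Kbar) :
  map_poly const (\prod_(c <- s) ('X - c%:P)) =
  \prod_(c <- map const s) ('X - c%:P).
Proof.
rewrite rmorph_prod big_map; apply: eq_bigr => c _.
by rewrite rmorphB /= map_polyX map_polyC.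
Qed.

(** The orbit polynomial of [y] over K(x) has constant coefficients, which by separability lie in
    K(x) and so in [K]. *)
Lemma separable_const y :
  separable_elements Kx (const y) -> separable_elements (range i) y.
Proof.
move=> y_sep; have HKx : is_subfield Kx by exact: range_subfield.
have Kx_alg z : algebraic_over Kx z by exact: algebraic_over_embed.
have [s [us ys sP st]] := conjugates_const y HKx (@subset_refl _ Kx).
have [c /mapP[d ds ->]|F' [HF' KxF' F's fF']] :=
    @adjoin_separable_seq _ Kx (map const s) HKx Kx_alg.
  by have [t tKx ->] := sP d ds; exact: separable_conjugate.
exists (\prod_(c <- s) ('X - c%:P)); split.
- move=> n; have [u _] : Kx (const (\prod_(c <- s) ('X - c%:P))`_n).
    apply: fF'; rewrite -[const _]coef_map map_prod_const; split.
      exact: fixed_prod_XsubC.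
    exact: subfield_prod_XsubC.
  move=> uE; apply: (ratfun_map_eq_const (u := u)); apply: (fmorph_inj j).
  exact: uE.
- by apply: prod_XsubC_separable; move: us; rewrite map_inj_uniq //; exact: fmorph_inj.
- by rewrite root_prod_XsubC.
Qed.

Lemma separable_embed y :
  separable_elements (range i) y -> separable_elements Kx (const y).
Proof.
move=> [p [pK p_sep py]]; exists (map_poly const p); split.
- by move=> n; rewrite coef_map; have [c _ <-] := pK n; exact: const_base.
- by rewrite separable_map.
- by rewrite fmorph_root.
Qed.

Variables (N : set Om) (a : Kbar).
Hypotheses (HN : is_subfield N) (N_hens : henselian w N) (KxN : Kx `<=` N).

Let Kc : set Kbar := [set c | fixed_field N (const c)].

Lemma constants_subfield : is_subfield Kc.
Proof.
have HN' := fixed_field_subfield N; apply/is_subfieldP; split=> [|c d|c d].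
- by have := subfield1 HN'; rewrite -(rmorph1 const).
- by move=> Fc Fd; have := subfieldB HN' Fc Fd; rewrite -rmorphB.
- by move=> Fc Fd; have := subfield_div HN' Fc Fd; rewrite -fmorph_div.
Qed.

Lemma constants_henselian : henselian (val_comp w const) Kc.
Proof.
apply: (henselian_conjugates constants_subfield) => z.
have [s [us zs sP st]] := conjugates_const z HN KxN.
have inv t u := henselian_invariant (t := t) u N_hens.
exists s; split=> //.
- move=> n; have := @fixed_prod_XsubC _ N _ us st n.
  by rewrite -map_prod_const coef_map.
- move=> c /sP[t tN cE]; rewrite !in_ringE !val_compE rmorph1 -!in_ringE cE.
  by rewrite inv.
- move=> c /sP[t tN cE]; rewrite !val_compE rmorph1 cE invariant_ideal // => u.
  exact: inv.
Qed.

(* Krasner's argument: a conjugate a' of a over N satisfies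
   x - a' = t (x - a), so that a' - a is infinitesimal. *)
Lemma constants_generator :
  infinitesimal j w (eval j ('X - a%:P)) -> Kc a.
Proof.
move=> xa_inf t tN; have inv u := henselian_invariant u N_hens tN.
have inv_lt u v : u != 0 -> vlt (w u) (w v) -> vlt (w (t u)) (w (t v)).
  move=> u0 uv; have tu0 : t u != 0 by rewrite fmorph_eq0.
  rewrite -(vlt_mul2r w _ _ (c := (t u)^-1)) ?invr_eq0 // divff //.
  rewrite -fmorph_div invariant_ideal // -(divff u0).
  by rewrite vlt_mul2r ?invr_eq0.
(* Since [t] permutes the conjugates of a constant, each constant bound is the image under [t] of a
   constant bound, and [t] preserves comparisons of values. *)
have txa_inf : infinitesimal j w (t (eval j ('X - a%:P))).
  move=> c c0; have [s [us cs sP st]] := conjugates_const c HN KxN.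
  have : const c \in map t (map const s).
    by rewrite (perm_mem (stable_perm us (st t tN))) map_f.
  case/mapP=> _ /mapP[d ds ->] cE; rewrite cE; apply: inv_lt.
    by rewrite fmorph_eq0; apply: contraNneq c0 => d0; rewrite -(fmorph_eq0 const) cE d0 !rmorph0.
  apply: xa_inf; apply: contraNneq c0 => d0.
  by rewrite -(fmorph_eq0 const) cE d0 !rmorph0.
have [a' aE] := fixes_const a KxN tN.
have tx : t (eval j 'X) = eval j 'X.
  by apply: tN; apply: KxN; exists (ratfun_poly 'X); rewrite //= ratfun_map_poly map_polyX.
have := infinitesimalB xa_inf txa_inf.
rewrite [eval j _]rmorphB evalC rmorphB tx aE.
have -> : eval j 'X - const a - (eval j 'X - const a') = const (a' - a).
  by rewrite rmorphB; ring.
move/infinitesimal_const/eqP; rewrite subr_eq0 => /eqP ->.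
by [].
Qed.

End OverHenselian.

Theorem theorem7p2 (G : oagType)
    (K : fieldType) (nu : valuation K G)
    (omega : valuation (ratfun K) G)
    (omega_nu : extends (@ratfun_const K) nu omega)
    (omega_vt : valuation_transcendental nu omega)
    (Kbar : closedFieldType) (i : {rmorphism K -> Kbar})
    (Kbar_alg : is_algebraic i)
    (nubar : valuation Kbar G) (nubar_nu : extends i nu nubar)
    (omegabar : valuation (ratfun Kbar) G)
    (omegabar_omega : extends (ratfun_map i) omega omegabar)
    (omegabar_nubar : extends (@ratfun_const Kbar) nubar omegabar)
    (Om : closedFieldType) (j : {rmorphism ratfun Kbar -> Om})
    (Om_alg : is_algebraic j)
    (w : valuation Om G) (w_omegabar : extends j omegabar w)
    (a : Kbar) (gamma : G)
    (a_gamma : minimal_pair_of_definition i nubar omegabar a gamma)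
    (gamma_gt : forall alpha : G, value_group nubar alpha -> alpha < gamma) :
  implicit_constant_field i j w =
  separable_closure_in i (henselization nubar (simple_ext i a)).
Proof.
have wconst c : w (const j c) = nubar c.
  by rewrite -omegabar_nubar -w_omegabar.
have nubarO : in_valuation_ring (val_comp w (const j)) =i in_valuation_ring nubar.
  by move=> c; rewrite !in_ringE !val_compE !wconst.
(* The monomial formula at ['X] gives x - a the value [gamma]: the coefficients 0 and 1 contribute
   infinity and [gamma]. *)
have xa_inf : infinitesimal j w (eval j ('X - a%:P)).
  have [[_ mono] _] := a_gamma; have := mono 'X; rewrite comp_polyX size_polyX.
  rewrite !big_ord_recl big_ord0 /= !coefX /= val0 Defs.val1 /=.
  rewrite -w_omegabar => xa c c0; rewrite wconst.
  have [g cg] := val_neq0 nubar c0.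
  rewrite xa cg /vmin /= add0r mulr1n.
  have gg : g < gamma by apply: gamma_gt; exists c.
  by rewrite /vlt /= ltW // andbT; apply/eqP => -[] gE; rewrite gE ltxx in gg.
have base_sub (E : set Kbar) : simple_ext i a `<=` E -> range i `<=` E /\ E a.
  by move=> aE; split=> [c ic|]; apply: aE => F [_ FE]; apply: FE; [left|right].
apply/seteqP; split=> y.
  move=> y_ic.
  have y_sep : separable_elements (range i) y.
    apply: (separable_const (j := j) Kbar_alg Om_alg).
    have HKx : is_subfield (range (embed_ratfun i j)) by exact: range_subfield.
    have Kx_alg := algebraic_over_embed Kbar_alg Om_alg.
    apply: y_ic; split; last exact: sub_separable_elements.
    split; first exact: separable_elements_subfield.
    apply: henselian_powers => z.
    have [q [q_nat zq]] := separable_pow HKx Kx_alg z.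
    by exists q => //; case: (q) q_nat.
  split; last exact/separable_overP.
  move=> E [[HE E_hens] aE]; have [iE Ea] := base_sub E aE.
  have E_alg z : algebraic_over E z.
    by apply: algebraic_overS iE _; apply/algebraic_over_range.
  have [k [f EE]] := subfield_range HE.
  have f_alg : is_algebraic f by move=> z; apply/algebraic_over_range; rewrite -EE.
  have fa : range f a by rewrite -EE.
  have f_hens : henselian (val_comp w (const j)) (range f).
    by rewrite -EE; apply: henselian_eq E_hens => c; rewrite nubarO.
  have [M [HM M_hens KxM MK]] := henselian_over_ratfun Om_alg xa_inf f_alg fa f_hens.
  have yE : fixed_field E y.
    rewrite EE; apply: MK; apply: y_ic; split=> // _ [u _ <-]; apply: KxM.
    have [p [q [_ q0 ->]]] := ratfun_coprime u.
    have lift (r : {poly K}) : exists r', map_poly i r = map_poly f r'.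
      by apply: range_coef => n; rewrite -EE; apply: iE; exact: range_coef_map.
    have [[p' pE] [q' qE]] := (lift p, lift q).
    exists (ratfun_poly p' / ratfun_poly q') => //=.
    rewrite !ratfun_map_frac ?pE ?qE //.
    by rewrite -(map_poly_eq0 f) -qE map_poly_eq0.
  have [p [pE p_sep py]] := separable_elementsS iE y_sep.
  exact: fixed_field_separable p_sep py.
move=> [y_hens /separable_overP y_sep] N [[HN N_hens] KxN].
have N_alg z : algebraic_over N z.
  by apply: algebraic_overS KxN _; exact: algebraic_over_embed.
have yN : fixed_field N (const j y).
  have HL := constants_subfield j N.
  (* The henselization of K(a) is tested against the constants fixed over [N]. *)
  suff : [set c | fixed_field N (const j c)] y by [].
  apply: y_hens; split.
    split=> //; apply: henselian_eq nubarO _; exact: constants_henselian.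
  move=> c ac; apply: ac; split=> // d [[c' _ <-]|->].
    by apply: sub_fixed_field; apply: KxN; exact: const_base.
  exact: constants_generator xa_inf.
(* So far [y] is only purely inseparable over [N]; being also separable over [N], it lies in [N]. *)
have [p [pN p_sep py]] := separable_elementsS KxN (separable_embed j y_sep).
exact: fixed_field_separable p_sep py.
Qed.
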